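(* Let $q \geq 2$ be an integer and let $\mathcal{P}$ be a finite regular abstract $4$-polytope of type $\{3,q,3\}$, with medial layer graph $\mathcal{G}$. If $\mathcal{G}$ is vertex-transitive, then $\mathcal{G}$ is $3$-transitive and $\mathcal{P}$ is self-dual.
   Context: An abstract $4$-polytope is a partially ordered set $\mathcal{P}$ with a strictly monotone rank function onto $\{-1,0,1,2,3,4\}$, having a unique least face (rank $-1$) and a unique greatest face (rank $4$), such that every maximal chain (flag) contains exactly $6$ faces; whenever $F<G$ with $\mathrm{rank}(F)=j-1$, $\mathrm{rank}(G)=j+1$ there are exactly two faces $H$ of rank $j$ with $F<H<G$; and $\mathcal{P}$ is strongly flag-connected (for every section $G/F=\{H: F\le H\le G\}$, the graph on its flags, with flags adjacent when they differ in exactly one face, is connected). Faces of rank $j$ are $j$-faces. $\mathcal{P}$ is of type $\{p_1,p_2,p_3\}$ if for $j=1,2,3$, whenever $F<G$ with $\mathrm{rank}(F)=j-2$, $\mathrm{rank}(G)=j+1$, the section $G/F$ is (the face lattice of) a $p_j$-gon. $\mathcal{P}$ is regular if its automorphism group (order-preserving bijections) acts transitively on flags. $\mathcal{P}$ is self-dual if it admits an order-reversing bijection onto itself. The medial layer graph $\mathcal{G}$ of $\mathcal{P}$ is the simple graph whose vertices are the $1$-faces and $2$-faces of $\mathcal{P}$, two being adjacent when incident in $\mathcal{P}$; for type $\{3,q,3\}$ it is trivalent. A $t$-arc in a graph is a sequence of vertices $v_0,\dots,v_t$ with $v_{i-1}v_i$ an edge for all $i$ and $v_{i-1}\neq v_{i+1}$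 for all $i$. A graph is $t$-transitive if its automorphism group is transitive on $t$-arcs but not on $(t+1)$-arcs. *)

(* Defs.v *)
From HB Require Import structures.
From mathcomp Require Import all_boot all_order all_algebra all_fingroup.

Set Implicit Arguments.
Unset Strict Implicit.
Unset Printing Implicit Defensive.

Import Order.TTheory.

Local Open Scope order_scope.

Section Posets.

Variables (d : Order.disp_t) (P : finPOrderType d).

Definition is_chain (C : {set P}) : bool :=
  [forall x in C, forall y in C, x >=< y].

Definition flag (S C : {set P}) : bool :=
  maxset (fun D : {set P} => (D \subset S) && is_chain D) C.

Definition flag_adj (S : {set P}) : rel {set P} :=
  fun C D => [&& flag S C, flag S D, #|C :\: D| == 1%N & #|D :\: C| == 1%N].

Definition flag_connected (S : {set P}) : Prop :=
  forall C D : {set P}, flag S C -> flag S D -> connect (flag_adj S) C D.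

Definition psection (F G : P) : {set P} := [set H | F <= H <= G].

Record abstract_4polytope (rk : P -> int) : Prop := Abstract4Polytope {
  rank_mono : forall x y : P, x < y -> (rk x < rk y)%R;
  rank_bound : forall x : P, (-1 <= rk x <= 4)%R;
  rank_onto : forall j : int, (-1 <= j <= 4)%R -> exists x : P, rk x = j;
  least_face : exists2 F : P, rk F = (-1)%R & forall x : P, F <= x;
  greatest_face : exists2 F : P, rk F = 4%R & forall x : P, x <= F;
  flag_card : forall C : {set P}, flag [set: P] C -> #|C| = 6;
  diamond : forall (j : int) (F G : P), F < G ->
    rk F = (j - 1)%R -> rk G = (j + 1)%R ->
    #|[set H : P | [&& rk H == j, F < H & H < G]]| = 2;
  strongly_flag_connected :
    forall F G : P, F <= G -> flag_connected (psection F G)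
}.

Definition poset_automorphism (s : {perm P}) : Prop :=
  {mono s : x y / x <= y}.

Definition regular_polytope : Prop :=
  forall C D : {set P}, flag [set: P] C -> flag [set: P] D ->
    exists2 s : {perm P}, poset_automorphism s & s @: C = D.

Definition self_dual : Prop :=
  exists s : {perm P}, forall x y : P, (s x <= s y) = (y <= x).

End Posets.

Arguments regular_polytope {d} P.
Arguments self_dual {d} P.

Inductive polygon_face (p : nat) : Type :=
  | PgEmpty
  | PgVertex of 'I_p
  | PgEdge of 'I_p
  | PgWhole.

(* Edge j joins the vertices j and j + 1 mod p; for p = 2 this is the digon,
   whose two edges both join its two vertices. *)
Definition polygon_le (p : nat) (s t : polygon_face p) : bool :=
  match s, t with
  | PgEmpty, _ => true
  | _, PgWhole => true
  | PgVertex i, PgVertex j => i == j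
  | PgVertex i, PgEdge j => (i == j) || (i == j.+1 %% p :> nat)
  | PgEdge i, PgEdge j => i == j
  | _, _ => false
  end.

Section PolytopeType.

Variables (d : Order.disp_t) (P : finPOrderType d) (rk : P -> int).

Definition is_polygon (p : nat) (S : {set P}) : Prop :=
  exists g : polygon_face p -> P,
    [/\ injective g,
        forall x : P, x \in S <-> exists t, g t = x
      & forall s t, (g s <= g t) = polygon_le s t].

Definition sections_polygonal (j : int) (p : nat) : Prop :=
  forall F G : P, F < G -> rk F = (j - 2)%R -> rk G = (j + 1)%R ->
    is_polygon p (psection F G).

Definition of_type (p1 p2 p3 : nat) : Prop :=
  [/\ sections_polygonal 1%R p1, sections_polygonal 2%R p2
    & sections_polygonal 3%R p3].

Definition medial_vertex : finType :=
  {x : P | (rk x == 1%R) || (rk x == 2%R)}.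

Definition medial_adj : rel medial_vertex :=
  fun u v => (u != v) && (val u >=< val v).

Lemma medial_adj_sym : symmetric medial_adj.
Proof. by move=> u v; rewrite /medial_adj eq_sym comparable_sym. Qed.

Lemma medial_adj_irr : irreflexive medial_adj.
Proof. by move=> u; rewrite /medial_adj eqxx. Qed.

End PolytopeType.

Arguments medial_vertex {d P} rk.
Arguments medial_adj {d P} rk u v.

Section Graphs.

Variables (V : finType) (e : rel V).

Definition graph_automorphism (s : {perm V}) : Prop := {mono s : u v / e u v}.

Definition vertex_transitive : Prop :=
  forall u v : V, exists2 s : {perm V}, graph_automorphism s & s u = v.

Definition is_arc (t : nat) (v : 'I_t.+1 -> V) : Prop :=
  (forall i j : 'I_t.+1, j = i.+1 :> nat -> e (v i) (v j)) /\
  (forall i j : 'I_t.+1, j = i.+2 :> nat -> v i != v j).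

Definition arc_transitive (t : nat) : Prop :=
  forall v w : 'I_t.+1 -> V, is_arc v -> is_arc w ->
    exists2 s : {perm V}, graph_automorphism s & forall i, s (v i) = w i.

Definition t_transitive (t : nat) : Prop :=
  arc_transitive t /\ ~ arc_transitive t.+1.

End Graphs.

(* Main.v *)
Require Import Defs.
From mathcomp Require Import all_boot all_order all_algebra all_fingroup.
From mathcomp Require Import zify.
From Stdlib Require Import Classical_Prop.

(* Let A be the automorphism group of the medial layer graph.  A 3-arc starting
   at a 1-face encodes a flag: its first vertex is opposite to a 0-face in the
   second one, its last vertex opposite to a facet in the third one.  So regularity
   and vertex transitivity make A transitive on 3-arcs.  The automorphism of the
   polytope exchanging the two ends of an edge fixes the neighbours of that edge and
   moves every vertex at the next layer; conjugation gives such a "star flip" at every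
   vertex of the graph.

   Star flips exclude transitivity on 4-arcs.  Otherwise, for some 4-arc a_0 ... a_4,
   some automorphism fixing it moves a neighbour of the third neighbour b of a_2.  Take
   m maximal such that this happens for m-arcs; m exists because an automorphism shifting
   an arc yields a periodic arc, so A is not transitive on all arcs.  A commutator of two
   arc stabilisers then contradicts the choice of m.

   Hence only 1 fixes a 3-arc, and every rank-preserving automorphism of the graph comes
   from the polytope.  A rank-reversing graph automorphism t conjugates star flips to star
   flips, and walking around a 0-face or a facet is a succession of star flips; thus t
   exchanges 0-faces and facets and extends to a duality. *)

Set Implicit Arguments.
Unset Strict Implicit.
Unset Printing Implicit Defensive.

Import Order.TTheory.

Ltac nlia :=
  repeat match goal with H : ?T |- _ =>
    lazymatch T with is_true (leq _ _) => fail | nat => fail | _ => clear H end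
  end; lia.

Ltac is_int a := let T := type of a in unify T int.

Ltac ilia :=
  repeat match goal with H : ?T |- _ =>
    lazymatch T with
    | @eq _ ?a _ => tryif is_int a then fail else clear H
    | is_true (Order.le ?a _) => tryif is_int a then fail else clear H
    | is_true (Order.lt ?a _) => tryif is_int a then fail else clear H
    | _ => clear H
    end
  end; lia.

(** * Cubic graphs *)

Section CubicGraph.

Variables (V : finType) (e : rel V).
Hypothesis esym : symmetric e.
Hypothesis cubic : forall v, #|[set u | e v u]| = 3.
Hypothesis conn : forall u v, connect e u v.

Local Notation aut := (graph_automorphism e).

(** * Automorphisms and the three neighbours of a vertex *)

Lemma aut1 : aut 1%g.
Proof. by move=> u v; rewrite !perm1. Qed.

Lemma autM s t : aut s -> aut t -> aut (s * t)%g.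
Proof. by move=> sA tA u v; rewrite !permM tA sA. Qed.

Lemma autV s : aut s -> aut s^-1%g.
Proof. by move=> sA u v; rewrite -sA !permKV. Qed.

Lemma third_neighbour y a b : e y a -> e y b -> a != b ->
  exists c, [/\ e y c, c != a, c != b &
    forall x, e y x -> [\/ x = a, x = b | x = c]].
Proof.
move=> ya yb ab.
have sub : [set a; b] \subset [set u | e y u].
  by apply/subsetP=> x; rewrite !inE => /orP[] /eqP->.
have : #|[set u | e y u] :\: [set a; b]| == 1.
  by rewrite cardsD (setIidPr sub) cubic cards2 ab.
case/cards1P=> c cE; exists c.
have : c \in [set u | e y u] :\: [set a; b] by rewrite cE inE.
rewrite !inE negb_or => /andP[/andP[ca cb] yc]; split=> // x yx.
case: (eqVneq x a) => [->|xa]; first by constructor 1.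
case: (eqVneq x b) => [->|xb]; first by constructor 2.
have : x \in [set u | e y u] :\: [set a; b] by rewrite !inE negb_or xa xb.
by rewrite cE inE => /eqP->; constructor 3.
Qed.

Lemma neighbour_neq y a : exists2 b, e y b & b != a.
Proof.
have : 0 < #|[set u | e y u] :\ a|.
  by have := cardsD1 a [set u | e y u]; rewrite cubic; case: (a \in _) => /=; nlia.
by case/card_gt0P=> b; rewrite !inE => /andP[ba yb]; exists b.
Qed.

Lemma last_neighbour y a b c d : e y a -> e y b -> a != b ->
  e y c -> c != a -> c != b -> e y d -> d != a -> d != b -> c = d.
Proof.
move=> ya yb ab yc ca cb yd da db.
have [x [_ _ _ H]] := third_neighbour ya yb ab.
case: (H c yc) => E; first by rewrite E eqxx in ca.
  by rewrite E eqxx in cb.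
case: (H d yd) => E'; first by rewrite E' eqxx in da.
  by rewrite E' eqxx in db.
by rewrite E E'.
Qed.

(** An automorphism fixing [y] permutes its three neighbours, and a permutation of three points with
    two fixed points is trivial. *)
Lemma fix_neighbours g y a b : aut g -> g y = y -> e y a -> e y b -> a != b ->
  g a = a -> g b = b -> forall c, e y c -> g c = c.
Proof.
move=> gA gy ya yb ab ga gb c yc.
case: (eqVneq c a) => [->//|ca]; case: (eqVneq c b) => [->//|cb].
apply: (last_neighbour ya yb ab) => //.
- by rewrite -[y]gy gA.
- by rewrite -[a]ga (inj_eq perm_inj).
- by rewrite -[b]gb (inj_eq perm_inj).
Qed.

Lemma move_neighbours g y a p : aut g -> g y = y -> e y a -> g a = a ->
  e y p -> g p != p -> forall c, e y c -> c != a -> g c != c.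
Proof.
move=> gA gy ya ga yp gp c yc ca; apply: contra_neq gp => gc.
by apply: (fix_neighbours gA gy ya yc) => //; rewrite eq_sym.
Qed.

(** Both act on the neighbours of [y] as the transposition of the two that differ from [a]. *)
Lemma move_agree g h y a p : aut g -> aut h -> g y = y -> h y = y ->
  e y a -> g a = a -> h a = a -> e y p -> g p != p -> h p != p -> g p = h p.
Proof.
move=> gA hA gy hy ya ga ha yp gp hp.
have pa : p != a by apply: contra_neq gp => ->.
apply: (@last_neighbour y a p) => //; rewrite 1?eq_sym //.
- by rewrite -[y]gy gA.
- by rewrite eq_sym -[a]ga (inj_eq perm_inj).
- by rewrite -[y]hy hA.
- by rewrite eq_sym -[a]ha (inj_eq perm_inj).
Qed.

(** * Arcs and arc-transitivity *)

(* Arcs are handled as sequences of which only the first [m.+1] entries matter. *)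
Definition arc_seq m (a : nat -> V) :=
  (forall i, i < m -> e (a i) (a i.+1)) /\
  (forall i, i.+1 < m -> a i != a i.+2).

Definition arc_trans m := forall a b, arc_seq m a -> arc_seq m b ->
  exists2 s : {perm V}, aut s & forall i, i <= m -> s (a i) = b i.

Definition fixes (g : {perm V}) m (a : nat -> V) :=
  forall i, i <= m -> g (a i) = a i.

Lemma arc_transitiveE t : arc_transitive e t <-> arc_trans t.
Proof.
have arcP a : arc_seq t a -> is_arc e (fun i : 'I_t.+1 => a i).
  by move=> [a1 a2]; split=> i j ji; have := ltn_ord j; rewrite ji => it;
    [apply: a1 | apply: a2].
split=> [H a b aA bA|H v w [v1 v2] [w1 w2]].
  have [s sA sE] := H _ _ (arcP _ aA) (arcP _ bA).
  by exists s => // i it; have := sE (@Ordinal t.+1 i it).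
(* [inord] only extends the arcs to all of [nat]; indices beyond [t] never matter. *)
have [||s sA sE] := H (fun i => v (inord i)) (fun i => w (inord i)).
- by split=> i it; [apply: v1 | apply: v2]; rewrite !inordK; nlia.
- by split=> i it; [apply: w1 | apply: w2]; rewrite !inordK; nlia.
by exists s => // i; have := sE i; rewrite inord_val -ltnS ltn_ord => ->.
Qed.

Lemma arcW m n a : m <= n -> arc_seq n a -> arc_seq m a.
Proof.
move=> mn [a1 a2]; split=> i im; first by apply: a1; nlia.
by apply: a2; nlia.
Qed.

Lemma arc_shift k m a : arc_seq (k + m) a -> arc_seq m (fun i => a (k + i)).
Proof.
move=> [a1 a2]; split=> i im; rewrite !addnS; first by apply: a1; nlia.
by apply: a2; nlia.
Qed.

Lemma arc_rev m a : arc_seq m a -> arc_seq m (fun i => a (m - i)).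
Proof.
move=> [a1 a2]; split=> i im.
  by rewrite esym; have := a1 (m - i.+1); rewrite -subSn // subSS; apply; nlia.
rewrite eq_sym; have := a2 (m - i.+2).
by rewrite -!subSn ?subSS //; [apply|]; nlia.
Qed.

(** * Extension of arcs *)

Definition extend (a : nat -> V) m p : nat -> V := fun i => if i <= m then a i else p.

Lemma extend_le a m p i : i <= m -> extend a m p i = a i.
Proof. by rewrite /extend => ->. Qed.

Lemma extendS a m p : extend a m p m.+1 = p.
Proof. by rewrite /extend ltnn. Qed.

Lemma arc_extend m a p : arc_seq m a -> e (a m) p -> (0 < m -> p != a m.-1) ->
  arc_seq m.+1 (extend a m p).
Proof.
move=> [a1 a2] amp pa; split=> i im.
  rewrite (extend_le _ _ (_ : i <= m)) //; move: im; rewrite ltnS leq_eqVlt.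
  case/orP=> [/eqP->|im]; first by rewrite extendS.
  by rewrite extend_le // a1.
rewrite (extend_le _ _ (_ : i <= m)); last nlia.
move: im; rewrite ltnS leq_eqVlt => /orP[/eqP im|im].
  by rewrite -im extendS eq_sym; move: pa; rewrite -im; apply.
by rewrite extend_le // a2.
Qed.

Lemma exists_arc x y : e x y ->
  exists2 a, (forall m, arc_seq m a) & a 0 = x /\ a 1 = y.
Proof.
move=> xy.
(* The state is a directed edge, continued without turning back; by [neighbour_neq] the default
   [d.1] is never taken. *)
pose next (d : V * V) := (d.2, odflt d.1 [pick z | e d.2 z & z != d.1]).
have nextP u v : e v (next (u, v)).2 /\ (next (u, v)).2 != u.
  rewrite /next /=; case: pickP => [z /andP[]//|H].
  by have [b vb bu] := neighbour_neq v u; have := H b; rewrite vb bu.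
pose a i := (iter i next (x, y)).1.
have a1 i : a i.+1 = (iter i next (x, y)).2 by [].
have a2 i : a i.+2 = (next (iter i next (x, y))).2 by [].
exists a; last by [].
move=> m; split=> i _.
  case: i => [//|i]; rewrite a2 a1.
  by case: (iter i next _) => u v; case: (nextP u v).
by rewrite a2 /a; case: (iter i next _) => u v; rewrite eq_sym; case: (nextP u v).
Qed.

Lemma fixes_extend g m a p : fixes g m a -> g p = p -> fixes g m.+1 (extend a m p).
Proof. by move=> ga gp i _; rewrite /extend; case: ifP => // /ga. Qed.

Lemma arc_last m a : 0 < m -> arc_seq m a -> e (a m) (a m.-1).
Proof. by case: m => // m _ [H _]; rewrite esym; apply: H. Qed.

(** * Longer arcs and rigidity *)

(** Both arcs can be brought to start with [a]. Their last vertices then lie among the two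
    neighbours of [a m] other than [a m.-1], and [g], which fixes [a], exchanges these two. *)
Lemma trans_succ m a g p : 0 < m -> arc_trans m -> arc_seq m a -> aut g -> fixes g m a ->
  e (a m) p -> g p != p -> arc_trans m.+1.
Proof.
move=> m0 tm aA gA ga ap gp b c bA cA.
have [s sA sE] := tm _ _ (arcW (leqnSn m) bA) aA.
have [t tA tE] := tm _ _ (arcW (leqnSn m) cA) aA.
have aend := arc_last m0 aA.
have ext d u : arc_seq m.+1 d -> aut u -> (forall i, i <= m -> u (d i) = a i) ->
    e (a m) (u (d m.+1)) /\ u (d m.+1) != a m.-1.
  move=> [d1 d2] uA uE; split; first by rewrite -uE // uA d1.
  rewrite -uE ?leq_pred // (inj_eq perm_inj) eq_sym.
  by case: (m) m0 d2 => // k _; apply.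
have [sb sb'] := ext _ _ bA sA sE; have [tc tc'] := ext _ _ cA tA tE.
suff [k kA [ka kE]] : exists2 k : {perm V}, aut k &
    fixes k m a /\ k (s (b m.+1)) = t (c m.+1).
  exists (s * k * t^-1)%g; first by apply: autM (autV tA); apply: autM.
  move=> i; rewrite leq_eqVlt !permM => /orP[/eqP->|im]; first by rewrite kE permK.
  by rewrite sE // ka // -tE // permK.
case: (eqVneq (s (b m.+1)) (t (c m.+1))) => [E|N].
  by exists 1%g; [exact: aut1|split=> [i _|]; rewrite perm1].
exists g => //; split=> //.
have gm : g (a m) = a m by apply: ga.
have gm' : g (a m.-1) = a m.-1 by apply: ga; rewrite leq_pred.
have := move_neighbours gA gm aend gm' ap gp sb sb' => gs.
apply: (@last_neighbour (a m) (a m.-1) (s (b m.+1))) => //; rewrite 1?eq_sym //.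
- by rewrite -gm gA.
- by rewrite -gm' (inj_eq perm_inj) eq_sym.
Qed.

(* The set of ends of the [m]-arcs fixed by [g] is closed under adjacency. *)
Lemma rigid m : 0 < m ->
  (forall a g, arc_seq m a -> aut g -> fixes g m a -> forall w, e (a m) w -> g w = w) ->
  forall a g, arc_seq m a -> aut g -> fixes g m a -> g = 1%g.
Proof.
move=> m0 H a g aA gA ga; apply/permP => x; rewrite perm1.
suff [b [_ bg <-]] : exists b, [/\ arc_seq m b, fixes g m b & b m = x] by rewrite bg.
have /connectP[p pP ->] := conn (a m) x.
elim/last_ind: p pP => [|p z IH]; first by exists a.
rewrite rcons_path last_rcons => /andP[/IH[b [bA bg <-]] bz].
(* A step back onto [b m.-1] does not extend the arc. Applying [H] to the reversed arc yields a
   fixed neighbour [y] of [b 0], and the arc is prolonged on that side instead. *)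
case: (eqVneq z (b m.-1)) => [->|zb].
  have rA := arc_rev bA; have rg : fixes g m (fun i => b (m - i)).
    by move=> i _; apply: bg; nlia.
  have [y y1 y2] := neighbour_neq (b 0) (b 1).
  have gy : g y = y by apply: (H _ g rA) => //; rewrite subnn.
  exists (fun i => if i is j.+1 then b j else y); split.
  - case: bA => b1 b2; split=> -[|i] im.
    + by rewrite esym.
    + by apply: b1; nlia.
    + by [].
    + by apply: b2; nlia.
  - by move=> [|i] im //; apply: bg; nlia.
  - by case: (m) m0.
have gz : g z = z by apply: (H b).
exists (fun i => extend b m z (1 + i)); split; last by rewrite add1n extendS.
- by apply: arc_shift; apply: arc_extend.
- by move=> i im; apply: (fixes_extend bg gz); nlia.
Qed.

(** By [trans_succ], an arc stabiliser moving a neighbour of the last vertex would give transitivity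
    on arcs longer by one; so [rigid] applies. *)
Lemma trans_rigid m a g : 0 < m -> arc_trans m -> ~ arc_trans m.+1 ->
  arc_seq m a -> aut g -> fixes g m a -> g = 1%g.
Proof.
move=> m0 tm ntm; apply: rigid => // b h bA hA hb w bw.
by apply/eqP; apply: contra_notT ntm; apply: (trans_succ m0 tm bA hA hb bw).
Qed.

(** * Boundedness of arc-transitivity *)

(** A [g] shifting a 4-arc by one step generates a non-backtracking walk [b], periodic because [g]
    has finite order. A long initial arc of [b] cannot be mapped to the arc that differs from it
    only in the last vertex, since that vertex of [b] has already occurred. *)
Lemma trans_bounded (x0 : V) : (forall m, 3 < m -> arc_trans m) -> False.
Proof.
move=> tr.
have [y y0 _] := neighbour_neq x0 x0.
have [a aA _] := exists_arc y0.
have [g gA gE] := tr 4 isT _ _ (aA 4) (arc_shift (aA (1 + 4))).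
pose b i := (g ^+ i)%g (a 0).
have bS i : b i.+1 = g (b i) by rewrite /b expgSr permM.
have b1 i : e (b i) (b i.+1).
  elim: i => [|i IH]; last by rewrite bS [b i.+2]bS gA.
  by rewrite bS /b expg0 perm1 gE // (aA 2).1.
have b2 i : b i != b i.+2.
  elim: i => [|i IH]; last by rewrite bS [b i.+3]bS (inj_eq perm_inj).
  by rewrite !bS /b expg0 perm1 !gE // (aA 3).2.
(* With this length [b n.+2] is [b 5], and the index 5 lies in the range [i <= n.+1] where both arcs
   coincide. *)
pose n := (#[g]%g + 3)%N.
have bA k : arc_seq k b by split=> i _.
have [z [z1 z2 z3 _]] := third_neighbour (arc_last (isT : 0 < n.+1) (bA _)) (b1 n.+1) (b2 n).
have cA : arc_seq n.+2 (extend b n.+1 z) by apply: arc_extend.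
have n3 : 3 < n.+2 by rewrite /n; nlia.
have [s sA sE] := tr n.+2 n3 _ _ (bA _) cA.
have E : b n.+2 = b 5.
  by rewrite /b /n -!addnS expgD expg_order mul1g.
have := sE n.+2 (leqnn _); rewrite extendS E sE; last by rewrite /n; nlia.
rewrite extend_le; last by have := order_gt0 g; rewrite /n; nlia.
by move=> zE; rewrite -zE -E eqxx in z3.
Qed.

(** * Arc stabilisers moving a vertex beside the arc *)

(** For [m > 3], [b] is the neighbour of [a 2] off the arc: it is fixed by the stabiliser of the
    arc, which nevertheless acts nontrivially on the neighbours of [b]. *)
Definition moves_side m := exists a g b w, [/\ arc_seq m a, aut g & fixes g m a] /\
  [/\ e (a 2) b, b != a 1, b != a 3, e b w & g w != w].

(** By rigidity, failure of transitivity on [m.+1]-arcs would leave only the identity fixing an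
    [m]-arc. *)
Lemma moves_side_trans m : 3 < m -> arc_trans m -> moves_side m -> arc_trans m.+1.
Proof.
move=> m3 tm [a [g [b [w [[aA gA ga] [_ _ _ _ gw]]]]]].
apply: NNPP => ntm; move: gw.
by rewrite (trans_rigid _ tm ntm aA gA ga) ?perm1 ?eqxx //; nlia.
Qed.

(** A conjugate [g] of the witness of [moves_side m] fixes [a] and moves [w]. Since
    [moves_side m.+1] fails, whatever fixes both [a] and [p] also fixes the neighbours of [b]; hence
    [g] moves [p]. Now [g] and [h] agree at [p], so [g * h^-1] fixes [w], and [h w = w] would give
    [g w = w]. *)
Lemma moves_side_all m a h p b w : 3 < m -> arc_trans m -> moves_side m ->
  ~ moves_side m.+1 -> arc_seq m a -> aut h -> fixes h m a ->
  e (a m) p -> p != a m.-1 -> h p != p ->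
  e (a 2) b -> b != a 1 -> b != a 3 -> e b w -> w != a 2 -> h w != w.
Proof.
move=> m3 tm [a' [g' [b' [w' [[aA' gA' ga'] [ab' b1' b3' bw' gw']]]]]] nS.
move=> aA hA ha ap pa hp ab b1 b3 bw wa.
have [s sA sE] := tm _ _ aA' aA.
have m0 : 0 < m by nlia.
have am : e (a m) (a m.-1) by apply: arc_last.
have a21 : e (a 2) (a 1) by rewrite esym; apply: aA.1; nlia.
have a23 : e (a 2) (a 3) by apply: aA.1; nlia.
have a13 : a 1 != a 3 by apply: aA.2; nlia.
pose g := (s^-1 * g' * s)%g.
have gE x : g (s x) = s (g' x) by rewrite !permM permK.
have gA : aut g by exact: (autM (autM (autV sA) gA') sA).
have ga : fixes g m a by move=> i im; rewrite -sE // gE ga'.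
have sb : s b' = b.
  apply: (last_neighbour a21 a23 a13) => //.
  - by rewrite -(sE 2) ?sA //; nlia.
  - by rewrite -(sE 1) ?(inj_eq perm_inj) //; nlia.
  - by rewrite -(sE 3) ?(inj_eq perm_inj) //; nlia.
have ga2 : g (a 2) = a 2 by apply: ga; nlia.
have gb : g b = b.
  by apply: (fix_neighbours gA ga2 a21 a23 a13) => //; apply: ga; nlia.
have gsw : g (s w') != s w' by rewrite gE (inj_eq perm_inj).
have bsw : e b (s w') by rewrite -sb sA.
have ba : e b (a 2) by rewrite esym.
have gw : g w != w by apply: (move_neighbours gA gb ba ga2 bsw gsw).
have tail k : aut k -> fixes k m a -> k p = p -> forall x, e b x -> k x = x.
  move=> kA ka kp x bx; apply/eqP; apply: contra_notT nS => kx.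
  exists (extend a m p), k, b, x; rewrite !extend_le; try nlia.
  by split; split=> //; [apply: arc_extend|apply: fixes_extend].
have gm : g (a m) = a m by apply: ga.
have hm : h (a m) = a m by apply: ha.
have gm' : g (a m.-1) = a m.-1 by apply: ga; nlia.
have hm' : h (a m.-1) = a m.-1 by apply: ha; nlia.
have gp : g p != p.
  by apply/negP => /eqP gp; move/negP: gw; apply; apply/eqP; apply: tail gp _ bw.
apply: contra_neq gw => hw.
have ghp := move_agree gA hA gm hm am gm' hm' ap gp hp.
have kA : aut (g * h^-1)%g by exact: (autM gA (autV hA)).
have ka : fixes (g * h^-1)%g m a.
  by move=> i im; rewrite permM ga // -{1}(ha i im) permK.
have kp : (g * h^-1)%g p = p by rewrite permM ghp permK.
by have := congr1 h (tail _ kA ka kp _ bw); rewrite permM permKV hw.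
Qed.

(* The commutator of [x] and [y] fixes the arc [a 1, ..., a m.+1] and moves
   [a m.+2], yet acts trivially around [a 3] because [x] and [y] both fix the
   neighbours of [a 3] and permutations of a 2-element set commute. *)
Lemma moves_side_succ m (x0 : V) : 3 < m -> arc_trans m -> moves_side m ->
  moves_side m.+1.
Proof.
move=> m3 tm sm; apply: NNPP => nS.
have tS := moves_side_trans m3 tm sm.
have [y0 xy0 _] := neighbour_neq x0 x0.
have [a aA _] := exists_arc xy0.
have a1 i : e (a i) (a i.+1) by apply: (aA i.+1).1.
have a1' i : e (a i.+1) (a i) by rewrite esym.
have a2 i : a i != a i.+2 by apply: (aA i.+2).2.
have third i : exists c, [/\ e (a i.+1) c, c != a i & c != a i.+2].
  by have [c [c1 c2 c3 _]] := third_neighbour (a1' i) (a1 i.+1) (a2 i); exists c.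
have [bm [bm1 bm2 bm3]] := third m.-1; rewrite prednK in bm1 bm3; last nlia.
have [b2 [b21 b22 b23]] := third 1.
have [b3 [b31 b32 b33]] := third 2.
have am1 : e (a m) (a m.-1) by have := a1' m.-1; rewrite prednK //; nlia.
have am2 : a m.-1 != a m.+1 by have := a2 m.-1; rewrite prednK //; nlia.
(* [x] fixes [a 0, ..., a m] and moves [a m.+1]; below, [y] fixes [a 2, ..., a m.+2] and moves
   [a 1], being obtained from the reversed arc. *)
have [x xA xE] : exists2 x : {perm V}, aut x & fixes x m a /\ x (a m.+1) = bm.
  have [|s sA sE] := tS _ (extend a m bm) (aA _).
    by apply: arc_extend => // _.
  exists s => //; split=> [i im|]; last by rewrite sE // extendS.
  by rewrite sE ?extend_le //; nlia.
have [y yA [yE ya1]] : exists2 y : {perm V}, aut y &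
    (forall i, 1 < i -> i <= m.+2 -> y (a i) = a i) /\ y (a 1) = b2.
  pose r i := a (m.+2 - i).
  have rA := arc_rev (aA m.+2); rewrite -/r in rA.
  have rm : r m = a 2 by congr a; nlia.
  have rm1 : r m.-1 = a 3 by congr a; nlia.
  have [|s sA sE] := tS r (extend r m b2) (arcW (leqnSn _) rA).
    apply: arc_extend; first by apply: arcW rA; nlia.
    - by rewrite rm.
    - by rewrite rm1.
  exists s => //; split=> [i i1 im|].
    have -> : a i = r (m.+2 - i) by congr a; nlia.
    by rewrite sE ?extend_le //; nlia.
  have -> : a 1 = r m.+1 by congr a; nlia.
  by rewrite sE // extendS.
case: xE => xE xam.
have xam_m : x (a m) = a m by apply: xE.
have xam1 : x (a m.-1) = a m.-1 by apply: xE; nlia.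
have xm1 : x (a m.+1) != a m.+1 by rewrite xam.
have xbm : x bm = a m.+1.
  have H : x bm != bm by apply: (move_neighbours xA xam_m am1 xam1 (a1 m) xm1).
  apply: (@last_neighbour (a m) (a m.-1) bm) => //; try (by rewrite eq_sym).
  - by rewrite -{1}xam_m xA.
  - by rewrite -xam1 (inj_eq perm_inj).
have y2 : y (a 2) = a 2 by apply: yE; nlia.
have y3 : y (a 3) = a 3 by apply: yE; nlia.
have yb2 : y b2 = a 1.
  have H : y b2 != b2.
    by apply: (move_neighbours yA y2 (a1 2) y3 (a1' 1)); rewrite // ya1.
  apply: (@last_neighbour (a 2) (a 3) b2) => //; try (by rewrite eq_sym).
  - by rewrite -{1}y2 yA.
  - by rewrite -y3 (inj_eq perm_inj).
have xb2 : x b2 = b2.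
  by apply: (fix_neighbours xA _ (a1' 1) (a1 2)) => //; apply: xE; nlia.
have ybm : y bm = bm.
  by apply: (fix_neighbours yA _ am1 (a1 m)) => //; apply: yE; nlia.
have K z : aut z -> (forall i, 1 < i -> i <= 4 -> z (a i) = a i) -> z b3 = b3.
  by move=> zA zE; apply: (fix_neighbours zA _ (a1' 2) (a1 3)) => //; apply: zE.
have xb3 : x b3 = b3 by apply: K => // i _ i4; apply: xE; nlia.
have yb3 : y b3 = b3 by apply: K => // i i1 i4; apply: yE; nlia.
(* The order of the factors makes [h] carry [y (x r)] to [x (y r)], so its values are computed by
   choosing [r]. *)
pose h := ((x * y)^-1 * (y * x))%g.
have hE r : h (y (x r)) = x (y r) by rewrite -[y (x r)]permM -[x (y r)]permM [h _]permM permK.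
have hA : aut h by exact: (autM (autV (autM xA yA)) (autM yA xA)).
pose c i := a (1 + i).
have hc : fixes h m c.
  move=> [|i] im; rewrite /c.
    by rewrite addn0 -{1}yb2 -{1}xb2 hE yb2; apply: xE; nlia.
  move: im; rewrite leq_eqVlt => /orP[/eqP->|im].
    have ym1 : y (a m.+1) = a m.+1 by apply: yE; nlia.
    by rewrite add1n -{1}ym1 -{1}xbm hE ybm.
  have yi : y (a (1 + i.+1)) = a (1 + i.+1) by apply: yE; nlia.
  have xi : x (a (1 + i.+1)) = a (1 + i.+1) by apply: xE; nlia.
  by rewrite -{1}yi -{1}xi hE yi.
(* Since [a m.+2 = y (x r)], this amounts to [y r != r]. As [r] is a neighbour of [bm] other than
   [a m], [moves_side_all] for [y] along the reversed arc gives it. *)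
have hp : h (a m.+2) != a m.+2.
  pose r := (x^-1)%g (a m.+2).
  have xr : x r = a m.+2 by rewrite permKV.
  rewrite -{1}(yE m.+2) // -{1}xr hE -xr (inj_eq perm_inj).
  pose r' i := a (m.+2 - i).
  have rA := arc_rev (aA m.+2); rewrite -/r' in rA.
  have r2 : r' 2 = a m by congr a; nlia.
  have r1 : r' 1 = a m.+1 by congr a; nlia.
  have r3 : r' 3 = a m.-1 by congr a; nlia.
  have rm : r' m = a 2 by congr a; nlia.
  have rm1 : r' m.-1 = a 3 by congr a; nlia.
  apply: (@moves_side_all m r' y (a 1) bm r); rewrite ?rm ?rm1 ?r1 ?r2 ?r3 //.
  - by apply: arcW rA; nlia.
  - by move=> i im; apply: yE; nlia.
  - by rewrite ya1.
  - by rewrite -xA xr xbm.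
  - by rewrite -(inj_eq (@perm_inj _ x)) xr xam_m eq_sym.
have [w b3w wa] := neighbour_neq b3 (a 3).
have hw : h w = w.
  have b3a : e b3 (a 3) by rewrite esym.
  have x3 : x (a 3) = a 3 by apply: xE; nlia.
  have [w' b3w' [w'a w'w only]] : exists2 w', e b3 w' & [/\ w' != a 3, w' != w &
      forall z, e b3 z -> z != a 3 -> z = w \/ z = w'].
    have [|w' [b3w' w'a w'w only]] := third_neighbour b3a b3w.
      by rewrite eq_sym.
    exists w' => //; split=> // z /only[->|->|->]; rewrite ?eqxx //; by [left|right].
  have im (z : {perm V}) v : aut z -> z b3 = b3 -> z (a 3) = a 3 -> e b3 v -> v != a 3 ->
      z v = w \/ z v = w'.
    move=> zA zb za b3v va; apply: only; first by rewrite -zb zA.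
    by rewrite -za (inj_eq perm_inj).
  have inj (z : {perm V}) : z w = z w' -> False.
    by move/perm_inj => E; rewrite E eqxx in w'w.
  case: (im x w xA xb3 x3 b3w wa) => xw; case: (im y w yA yb3 y3 b3w wa) => yw;
  case: (im x w' xA xb3 x3 b3w' w'a) => xw'; case: (im y w' yA yb3 y3 b3w' w'a) => yw';
  try (by case: (inj x); rewrite xw xw'); try (by case: (inj y); rewrite yw yw').
  - by rewrite -{1}yw -{1}xw hE yw.
  - by rewrite -{1}yw' -{1}xw' hE yw'.
  - by rewrite -{1}yw -{1}xw' hE yw'.
  - by rewrite -{1}yw' -{1}xw hE yw.
(* [moves_side_all] for [h] along [a 1, ..., a m.+1] contradicts [hw]. *)
suff : h w != w by rewrite hw eqxx.
have cm1 : c m.-1 = a m by congr a; nlia.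
apply: (@moves_side_all m c h (a m.+2) b3 w); rewrite ?cm1 //.
- exact: arc_shift (aA (1 + m)).
- exact: a1.
- by rewrite eq_sym.
Qed.

(** * Star flips exclude transitivity on 4-arcs *)

Definition star_flip (r : {perm V}) v := [/\ aut r, r v = v,
  forall u, e v u -> r u = u &
  forall u w, e v u -> e u w -> w != v -> r w != w].

Lemma star_flip_conj r v t : aut t -> star_flip r v -> star_flip (t^-1 * r * t)%g (t v).
Proof.
move=> tA [rA rv ru rw].
have E x : (t^-1 * r * t)%g (t x) = t (r x) by rewrite !permM permK.
split; first by exact: (autM (autM (autV tA) rA) tA).
- by rewrite E rv.
- by move=> u; rewrite -[u](permKV t) tA E => /ru->.
- move=> u w; rewrite -[u](permKV t) -[w](permKV t) !tA E !(inj_eq perm_inj).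
  exact: rw.
Qed.

(** Transitivity on 4-arcs gives [g] fixing [p, n1, v, n3] and moving a vertex [q] beyond [n3].
    Beyond the third neighbour [b], either [g] is trivial or it agrees with [r]; in the second case
    [g * r^-1] is trivial beyond [b] and [n3] but not beyond [n1]. Thus some automorphism fixing [v]
    and its neighbours moves vertices beyond exactly one of them. *)
Lemma moves_side4 v r : star_flip r v -> arc_trans 4 -> moves_side 4.
Proof.
move=> [rA rv ru rw] t4.
suff [g [u [w [[gA gv vu uw gw] gN gF]]]] : exists g u w,
    [/\ [/\ aut g, g v = v, e v u, e u w & g w != w],
      forall x, e v x -> g x = x &
      forall x z, e v x -> x != u -> e x z -> g z = z].
  (* The arc is centred at [v] and passes through the two neighbours beyond which [g] is trivial. *)
  have [n1 vn1 n1u] := neighbour_neq v u.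
  have un1 : u != n1 by rewrite eq_sym.
  have [n2 [vn2 n2u n21 _]] := third_neighbour vu vn1 un1.
  have [p1 np1 p1v] := neighbour_neq n1 v.
  have [p2 np2 p2v] := neighbour_neq n2 v.
  exists (nth v [:: p1; n1; v; n2; p2]), g, u, w; split; split=> //=.
  - split=> -[|[|[|[|[|i]]]]] //= _; by [rewrite esym | rewrite eq_sym].
  - move=> [|[|[|[|[|i]]]]] //= _; try exact: gN.
      exact: (gF n1).
    exact: (gF n2).
  - by rewrite eq_sym.
have [n1 vn1 _] := neighbour_neq v v.
have [n3 vn3 n31] := neighbour_neq v n1.
have [b [vb b3 b1 onlyb]] := third_neighbour vn3 vn1 n31.
have [p n1p pv] := neighbour_neq n1 v.
have [q n3q qv] := neighbour_neq n3 v.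
have [w bw wv] := neighbour_neq b v.
have n1v : e n1 v by rewrite esym.
have n3v : e n3 v by rewrite esym.
have bv : e b v by rewrite esym.
have vq : v != q by rewrite eq_sym.
have [q' [n3q' q'v q'q _]] := third_neighbour n3v n3q vq.
have arcs z : e n3 z -> z != v -> arc_seq 4 (nth v [:: p; n1; v; n3; z]).
  move=> nz zv; split=> -[|[|[|[|[|i]]]]] //= _; by [rewrite esym | rewrite eq_sym].
have [g gA gE] := t4 _ _ (arcs q n3q qv) (arcs q' n3q' q'v).
have gp : g p = p := gE 0 isT.
have gn1 : g n1 = n1 := gE 1 isT.
have gv : g v = v := gE 2 isT.
have gn3 : g n3 = n3 := gE 3 isT.
have gq : g q != q by rewrite (gE 4 isT).
have gN := fix_neighbours gA gv vn3 vn1 n31 gn3 gn1.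
have gb : g b = b by apply: gN.
case: (eqVneq (g w) w) => gw.
  exists g, n3, q; split=> // x z vx x3 xz.
  case: (onlyb x vx) => E; [by rewrite E eqxx in x3 | |]; subst x.
    by apply: (fix_neighbours gA gn1 n1v n1p) => //; rewrite eq_sym.
  by apply: (fix_neighbours gA gb bv bw) => //; rewrite eq_sym.
pose k := (g * r^-1)%g.
have kA : aut k by exact: (autM gA (autV rA)).
have rVN x : r x = x -> r^-1%g x = x by move=> E; rewrite -{1}E permK.
have kN x : e v x -> k x = x by move=> vx; rewrite permM gN // rVN // ru.
have kv : k v = v by rewrite permM gv rVN.
have kw : k w = w.
  rewrite permM (@move_agree g r b v) ?permK //; first [exact: ru | exact: rw vb bw wv].
have kq : k q = q.
  rewrite permM (@move_agree g r n3 v) ?permK //; first [exact: ru | exact: rw vn3 n3q qv].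
have kp : k p != p.
  rewrite permM gp; apply: contra_neq (rw _ _ vn1 n1p pv) => E.
  by rewrite -{1}E permKV.
exists k, n1, p; split=> // x z vx x1 xz.
case: (onlyb x vx) => E; [|by rewrite E eqxx in x1|]; subst x.
  apply: (fix_neighbours kA _ n3v n3q) => //; by [apply: kN | rewrite eq_sym].
apply: (fix_neighbours kA _ bv bw) => //; by [apply: kN | rewrite eq_sym].
Qed.

(** Transitivity on [m]-arcs together with [moves_side m] holds for 4 and passes from [m] to [m.+1],
    against [trans_bounded]. *)
Theorem not_arc_trans4 v r : star_flip r v -> ~ arc_trans 4.
Proof.
move=> rv t4; apply: (@trans_bounded v) => m m3.
suff [] : arc_trans m /\ moves_side m by [].
elim: m m3 => // m IH; rewrite ltnS leq_eqVlt => /orP[/eqP<-|m3].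
  by split=> //; apply: moves_side4 rv t4.
have [tm sm] := IH m3; split; first exact: moves_side_trans.
exact: (moves_side_succ v).
Qed.

End CubicGraph.

(** * Regular polytopes of type {3,q,3} *)

Section Polytope.

Local Open Scope order_scope.

Variables (d : Order.disp_t) (P : finPOrderType d) (rk : P -> int).
Hypothesis hP : abstract_4polytope rk.

(** * Ranks, chains and flags *)

Lemma comparable_rank_lt x y : x >=< y -> (rk x < rk y)%R -> x < y.
Proof.
case/orP; rewrite le_eqVlt => /orP[/eqP->|//]; rewrite ?ltxx //.
by move/(rank_mono hP) => H1 H2; have := lt_trans H1 H2; rewrite ltxx.
Qed.

Lemma comparable_rank_eq x y : x >=< y -> rk x = rk y -> x = y.
Proof.
move=> xy E; apply/eqP; case/orP: xy; rewrite le_eqVlt => /orP[|/(rank_mono hP)] //.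
- by rewrite E ltxx.
- by rewrite eq_sym.
- by rewrite E ltxx.
Qed.

Lemma rank_bounds x : (-1 <= rk x)%R /\ (rk x <= 4)%R.
Proof. by have /andP := rank_bound hP x. Qed.

Lemma chainP (C : {set P}) :
  reflect (forall x y, x \in C -> y \in C -> x >=< y) (is_chain C).
Proof.
apply: (iffP 'forall_in_forall_inP) => H x; first by move=> y xC yC; apply: H.
by move=> xC y yC; apply: H.
Qed.

Lemma flagP (S C : {set P}) : flag S C ->
  [/\ C \subset S, is_chain C &
    forall x, x \in S -> (forall y, y \in C -> x >=< y) -> x \in C].
Proof.
case/maxsetP=> /andP[CS Cc] max; split=> // x xS xC.
have -> : C = x |: C; last by rewrite setU11.
apply/esym/max; last exact: subsetUr.
rewrite subUset sub1set xS CS; apply/chainP => y z.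
rewrite !inE => /orP[/eqP->|yC] /orP[/eqP->|zC]; rewrite ?comparablexx //.
- exact: xC.
- by rewrite comparable_sym xC.
- exact: (chainP C Cc).
Qed.

Lemma flag_extension (S C : {set P}) : C \subset S -> is_chain C ->
  exists2 D, flag S D & C \subset D.
Proof.
move=> CS Cc.
pose p (D : {set P}) := (D \subset S) && is_chain D.
have pC : p C by rewrite /p CS.
by have [D Df CD] := maxset_exists pC; exists D.
Qed.

(** The six faces of a flag are pairwise comparable, so they have distinct ranks, and only six ranks
    are available. *)
Lemma flag_rank (C : {set P}) j : flag [set: P] C -> (-1 <= j <= 4)%R ->
  exists2 x, x \in C & rk x = j.
Proof.
move=> Cf jj; have [_ /chainP Cc _] := flagP Cf.
pose s : seq int := [:: (-1); 0; 1; 2; 3; 4]%R.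
have u : uniq [seq rk x | x <- enum C].
  rewrite map_inj_in_uniq ?enum_uniq // => x y; rewrite !mem_enum => xC yC.
  exact/comparable_rank_eq/Cc.
have sub : {subset [seq rk x | x <- enum C] <= s}.
  move=> _ /mapP[x _ ->]; have [] := rank_bounds x; rewrite !inE; ilia.
have [|_ E] := uniq_min_size u sub; first by rewrite size_map -cardE (flag_card hP).
have : j \in s by move: jj => /andP[]; rewrite !inE; ilia.
by rewrite -E => /mapP[x xC ->]; exists x; rewrite // -mem_enum.
Qed.

(** Extend [C] to a flag of the whole poset. The face of rank [j] in that flag lies between [F] and
    [G] and is comparable with all of [C], so it belongs to [C] by maximality. *)
Lemma section_flagP (F G : P) (C : {set P}) : F <= G -> flag (psection F G) C ->
  [/\ F \in C, G \in C & forall j, (rk F <= j <= rk G)%R ->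
    exists2 x, x \in C & rk x = j].
Proof.
move=> FG Cf; have [/subsetP CS Cc Cmax] := flagP Cf.
have FC : F \in C.
  apply: Cmax => [|y /CS]; rewrite inE ?lexx // => /andP[Fy _].
  exact: le_comparable.
have GC : G \in C.
  apply: Cmax => [|y /CS]; rewrite inE ?lexx ?FG // => /andP[_ yG].
  exact: ge_comparable.
split=> // j /andP[j1 j2].
have [D Df /subsetP CD] := flag_extension (subsetT C) Cc.
have [_ /chainP Dc _] := flagP Df.
have [|x xD xj] := flag_rank Df (j := j).
  by apply/andP; have [? ?] := rank_bounds F; have [? ?] := rank_bounds G; split; ilia.
exists x => //; apply: Cmax => [|y yC]; last by apply: Dc => //; apply: CD.
have le a b : a \in D -> b \in D -> (rk a <= rk b)%R -> a <= b.
  move=> aD bD; rewrite le_eqVlt => /orP[/eqP|] r.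
    by rewrite (comparable_rank_eq (Dc _ _ aD bD) r).
  by apply/ltW/comparable_rank_lt => //; apply: Dc.
by rewrite inE; apply/andP; split; apply: le; rewrite ?xj //; apply: CD.
Qed.

Lemma section_flag_through (F G x : P) : F <= x -> x <= G ->
  exists2 C, flag (psection F G) C & x \in C.
Proof.
move=> Fx xG; have [||C Cf] := @flag_extension (psection F G) [set x].
- by rewrite sub1set inE Fx.
- by apply/chainP => y z; rewrite !inE => /eqP-> /eqP->; rewrite comparablexx.
by rewrite sub1set; exists C.
Qed.

Lemma face_between (x y : P) j : x <= y -> (rk x <= j <= rk y)%R ->
  exists z, [/\ x <= z, z <= y & rk z = j].
Proof.
move=> xy jj; have [C Cf _] := section_flag_through (lexx x) xy.
have [_ _ H] := section_flagP xy Cf; have [z zC zj] := H j jj.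
have [/subsetP CS _ _] := flagP Cf; have := CS z zC.
by rewrite inE => /andP[]; exists z.
Qed.

(** * Automorphisms preserve ranks *)

Lemma automorphism_inv (s : {perm P}) :
  poset_automorphism s -> poset_automorphism s^-1%g.
Proof. by move=> sA x y; rewrite -sA !permKV. Qed.

(** Induction on the rank: an automorphism preserves [<], and below [x] there is a face of the
    preceding rank. The shift by one makes rank -1 the base case. *)
Lemma automorphism_rank_le (s : {perm P}) x :
  poset_automorphism s -> (rk x <= rk (s x))%R.
Proof.
move=> sA; have [n] : exists n : nat, rk x = (n%:Z - 1)%R.
  by exists `|(rk x + 1)%R|%N; have [] := rank_bounds x; ilia.
elim: n x => [|n IH] x xn; first by have [] := rank_bounds (s x); ilia.
have [b rb bx] := least_face hP.
have [|z [_ zx zr]] := face_between (bx x) (j := (n%:Z - 1)%R).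
  by rewrite rb xn; apply/andP; split; ilia.
have zx' : z < x by rewrite lt_neqAle zx andbT; apply: contra_eq_neq zr => ->; ilia.
have : s z < s x by rewrite (leW_mono sA).
move/(rank_mono hP); have := IH z zr; ilia.
Qed.

Lemma automorphism_rank (s : {perm P}) x :
  poset_automorphism s -> rk (s x) = rk x.
Proof.
move=> sA; apply/eqP; rewrite eq_le automorphism_rank_le // andbT.
by have := automorphism_rank_le (s x) (automorphism_inv sA); rewrite permK.
Qed.

(** * Triangular sections and the neighbourhood of a medial vertex *)

(** The labels pair each vertex of the triangle with the opposite side: edge [i + 1] mod 3 joins the
    vertices [i + 1] and [i + 2], so [Y i] is the side that misses [X i]. *)
Lemma triangle (F G : P) : F < G -> rk G = (rk F + 3)%R -> is_polygon 3 (psection F G) ->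
  exists X Y : 'I_3 -> P, [/\ injective X, injective Y,
    forall i j, (X i <= Y j) = (i != j),
    forall x, ([/\ F <= x, x <= G & rk x = (rk F + 1)%R] <-> exists i, x = X i) &
    forall x, ([/\ F <= x, x <= G & rk x = (rk F + 2)%R] <-> exists i, x = Y i)].
Proof.
move=> FG rG [g [ginj gS gle]].
pose Y (i : 'I_3) := g (PgEdge (inord (i.+1 %% 3))).
pose X (i : 'I_3) := g (PgVertex i).
have glt s t : s <> t -> polygon_le s t -> g s < g t.
  move=> st; rewrite -gle lt_neqAle => ->; rewrite andbT.
  by apply/eqP => /ginj.
have inS t : F <= g t /\ g t <= G.
  by have /gS : exists t', g t' = g t; [exists t|rewrite inE => /andP].
have gF : g (PgEmpty 3) = F.
  apply/eqP; rewrite eq_le (inS _).1 andbT.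
  have /gS[t <-] : F \in psection F G by rewrite inE lexx ltW.
  by rewrite gle; case: t.
have gG : g (PgWhole 3) = G.
  apply/eqP; rewrite eq_le (inS _).2 /=.
  have /gS[t <-] : G \in psection F G by rewrite inE lexx ltW.
  by rewrite gle; case: t.
have ranks (i : 'I_3) : rk (g (PgVertex i)) = (rk F + 1)%R /\
    rk (g (PgEdge i)) = (rk F + 2)%R.
  have h1 : F < g (PgVertex i) by rewrite -gF; apply: glt.
  have h2 : g (PgVertex i) < g (PgEdge i) by apply: glt; rewrite //= eqxx.
  have h3 : g (PgEdge i) < G by rewrite -gG; apply: glt.
  by move: (rank_mono hP h1) (rank_mono hP h2) (rank_mono hP h3); split; ilia.
have modP (i : 'I_3) : (i.+1 %% 3 < 3)%N by rewrite ltn_mod.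
exists X, Y; split.
- by move=> i j /ginj[].
- move=> i j /ginj[/(congr1 val)]; rewrite /= !inordK // => E; apply: val_inj => /=.
  by case: i j E => [[|[|[|i]]] // ?] [[|[|[|j]]] // ?].
- move=> i j; rewrite gle /= -val_eqE /= inordK //.
  by case: i j => [[|[|[|i]]] // ?] [[|[|[|j]]] // ?].
- move=> x; split=> [[Fx xG rx]|[i ->]]; last by have [] := inS (PgVertex i); have [] := ranks i.
  have /gS[t E] : x \in psection F G by rewrite inE Fx.
  subst x; case: t {Fx xG} rx => [|i|i|].
  + by rewrite gF; ilia.
  + by exists i.
  + by rewrite (ranks i).2; ilia.
  + by rewrite gG; ilia.
- move=> x; split=> [[Fx xG rx]|[i ->]]; last first.
    have [] := inS (PgEdge (inord (i.+1 %% 3))).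
    by have [] := ranks (inord (i.+1 %% 3)).
  have /gS[t E] : x \in psection F G by rewrite inE Fx.
  subst x; case: t {Fx xG} rx => [|i|i|].
  + by rewrite gF; ilia.
  + by rewrite (ranks i).1; ilia.
  (* Edge [i] is [Y (i + 2)] because [i + 3] is [i] modulo 3. *)
  + exists (inord (i.+2 %% 3)); congr (g (PgEdge _)); apply: val_inj => /=.
    rewrite !inordK ?ltn_mod //.
    by case: i {rx} => [[|[|[|i]]] // ?].
  + by rewrite gG; ilia.
Qed.

Hypothesis tri_face : sections_polygonal rk 1%R 3.
Hypothesis tri_edge : sections_polygonal rk 3%R 3.

Local Notation V := (medial_vertex rk).
Local Notation e := (medial_adj rk).

Lemma medial_rank (u : V) : rk (val u) = 1%R \/ rk (val u) = 2%R.
Proof. by case/orP: (valP u) => /eqP; [left|right]. Qed.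

Lemma medial_adjP (u v : V) : e u v ->
  [/\ rk (val u) = 1%R, rk (val v) = 2%R & val u < val v] \/
  [/\ rk (val u) = 2%R, rk (val v) = 1%R & val v < val u].
Proof.
case/andP=> uv c; have N : rk (val u) <> rk (val v).
  by move/(comparable_rank_eq c)/val_inj => E; rewrite E eqxx in uv.
have c' : val v >=< val u by rewrite comparable_sym.
case: (medial_rank u) N => ru; case: (medial_rank v) => rv; rewrite ru rv // => _.
  by left; split=> //; apply: comparable_rank_lt; rewrite ?ru ?rv.
by right; split=> //; apply: comparable_rank_lt; rewrite ?ru ?rv.
Qed.

Lemma lt_medial_adj (u v : V) : val u < val v -> e u v.
Proof. by move=> uv; rewrite /medial_adj -val_eqE lt_eqF // lt_comparable. Qed.

(** The corners of a 2-face are its vertices, those of a 1-face the facets containing it; treating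
    both at once keeps the arguments on the graph invariant under duality. *)
Definition corner (c : P) (y : V) := (c >=< val y) &&
  ((rk c == 0%R) && (rk (val y) == 2%R) || (rk c == 3%R) && (rk (val y) == 1%R)).

(** The section above a 1-face or below a 2-face is a triangle. Its 2-faces, respectively 1-faces,
    are the neighbours of [y], its other proper faces the corners, and equal indices mean
    opposite. *)
Lemma medial_star (y : V) : exists (N : 'I_3 -> V) (C : 'I_3 -> P),
  [/\ injective N, injective C, forall u, (e y u <-> exists i, u = N i),
    forall c, (corner c y <-> exists i, c = C i) &
    forall i j, (C i >=< val (N j)) = (i != j)].
Proof.
have mk (W : 'I_3 -> P) : injective W ->
    (forall i, (rk (W i) == 1%R) || (rk (W i) == 2%R)) ->
    exists N : 'I_3 -> V, injective N /\ forall i, val (N i) = W i.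
  move=> Winj Wr; pose N i := insubd y (W i).
  have NE i : val (N i) = W i by apply: insubdK; apply: Wr.
  by exists N; split=> // i j E; apply: Winj; rewrite -!NE E.
case: (medial_rank y) => ry.
- have [t rt lt] := greatest_face hP.
  have yt : val y < t.
    by rewrite lt_neqAle lt andbT; apply/eqP => E; rewrite E rt in ry.
  have [||X [Y [Xi Yi XY XE YE]]] := triangle yt.
  + by rewrite ry rt.
  + by apply: tri_edge yt _ _; rewrite ?ry ?rt.
  have Xr i : rk (X i) = 2%R by have /XE[_ _] : exists k, X i = X k; [exists i | rewrite ry].
  have Yr i : rk (Y i) = 3%R by have /YE[_ _] : exists k, Y i = Y k; [exists i | rewrite ry].
  have [|N [Ni NE]] := mk X Xi; first by move=> i; rewrite Xr.
  exists N, Y; split=> //.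
  + move=> u; split=> [/medial_adjP[[_ ru yu]|[]]|[i ->]]; last 1 first.
    * apply: lt_medial_adj; rewrite NE.
      have /XE[yX _ _] : exists k, X i = X k by exists i.
      by rewrite lt_neqAle yX andbT; apply/eqP => E; have := Xr i; rewrite -E ry.
    * have /XE[i E] : [/\ val y <= val u, val u <= t & rk (val u) = (rk (val y) + 1)%R].
        by rewrite ltW // lt ru ry.
      by exists i; apply: val_inj; rewrite NE.
    * by rewrite ry.
  + move=> c; rewrite /corner ry /= andbF andbT /=; split=> [/andP[cy /eqP rc]|[i ->]].
      apply/YE; rewrite lt rc ry; split=> //; apply/ltW/comparable_rank_lt.
        by rewrite comparable_sym.
      by rewrite rc ry.
    rewrite Yr eqxx andbT; have /YE[yY _ _] : exists k, Y i = Y k by exists i.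
    exact: ge_comparable.
  + move=> i j; rewrite NE eq_sym -XY; apply/idP/idP => [c|/ge_comparable//].
    by apply/ltW/comparable_rank_lt; rewrite 1?comparable_sym // Xr Yr.
- have [b rb lb] := least_face hP.
  have bY : b < val y.
    by rewrite lt_neqAle lb andbT; apply/eqP => E; rewrite -E rb in ry.
  have [||X [Y [Xi Yi XY XE YE]]] := triangle bY.
  + by rewrite ry rb.
  + by apply: tri_face bY _ _; rewrite ?ry ?rb.
  have Xr i : rk (X i) = 0%R by have /XE[_ _] : exists k, X i = X k; [exists i | rewrite rb].
  have Yr i : rk (Y i) = 1%R by have /YE[_ _] : exists k, Y i = Y k; [exists i | rewrite rb].
  have [|N [Ni NE]] := mk Y Yi; first by move=> i; rewrite Yr.
  exists N, X; split=> //.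
  + move=> u; split=> [/medial_adjP[[]|[_ ru yu]]|[i ->]]; last 1 first.
    * rewrite medial_adj_sym; apply: lt_medial_adj; rewrite NE.
      have /YE[_ yX _] : exists k, Y i = Y k by exists i.
      by rewrite lt_neqAle yX andbT; apply/eqP => E; have := Yr i; rewrite E ry.
    * by rewrite ry.
    * have /YE[i E] : [/\ b <= val u, val u <= val y & rk (val u) = (rk b + 2)%R].
        by rewrite lb ltW // ru rb.
      by exists i; apply: val_inj; rewrite NE.
  + move=> c; rewrite /corner ry /= andbF andbT orbF; split=> [/andP[cy /eqP rc]|[i ->]].
      apply/XE; rewrite lb rc rb; split=> //; apply/ltW/comparable_rank_lt => //.
      by rewrite rc ry.
    rewrite Xr eqxx andbT; have /XE[_ yY _] : exists k, X i = X k by exists i.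
    exact: le_comparable.
  + move=> i j; rewrite NE -XY; apply/idP/idP => [c|/le_comparable//].
    by apply/ltW/comparable_rank_lt => //; rewrite Xr Yr.
Qed.

Lemma medial_cubic (y : V) : #|[set u | e y u]| = 3.
Proof.
have [N [_ [Ni _ NE _ _]]] := medial_star y.
have -> : [set u | e y u] = N @: 'I_3.
  apply/setP=> u; rewrite inE; apply/idP/imsetP => [/NE[i ->]|[i _ ->]].
    by exists i.
  by apply/NE; exists i.
by rewrite card_imset // card_ord.
Qed.

(** * Corners opposite to neighbours *)

Definition opposite (c : P) (x y : V) :=
  [&& e y x, corner c y & ~~ (c >=< val x)].

Lemma opposite_corner (x y : V) : e y x -> exists c, opposite c x y.
Proof.
have [N [C [Ni Ci NE CE CN]]] := medial_star y => /[dup] yx /NE[i xE].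
exists (C i); rewrite /opposite yx xE CN eqxx andbT.
by apply/CE; exists i.
Qed.

Lemma opposite_neighbour c (y : V) : corner c y -> exists x, opposite c x y.
Proof.
have [N [C [Ni Ci NE CE CN]]] := medial_star y => /[dup] cy /CE[i cE].
exists (N i); rewrite /opposite cy cE CN eqxx !andbT.
by apply/NE; exists i.
Qed.

Lemma opposite_inj_corner c c' (x y : V) : opposite c x y -> opposite c' x y -> c = c'.
Proof.
have [N [C [Ni Ci NE CE CN]]] := medial_star y.
case/and3P=> /NE[i ->] /CE[j ->]; rewrite CN negbK => /eqP->.
by case/and3P=> _ /CE[k ->]; rewrite CN negbK => /eqP->.
Qed.

Lemma opposite_inj_neighbour c (x x' y : V) :
  opposite c x y -> opposite c x' y -> x = x'.
Proof.
have [N [C [Ni Ci NE CE CN]]] := medial_star y.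
case/and3P=> /NE[i ->] /CE[j ->]; rewrite CN negbK => /eqP->.
by case/and3P=> /NE[k ->] _; rewrite CN negbK => /eqP->.
Qed.

Lemma opposite_other c (x y z : V) : opposite c x y -> e y z -> z != x -> c >=< val z.
Proof.
have [N [C [Ni Ci NE CE CN]]] := medial_star y.
case/and3P=> /NE[i ->] /CE[j ->]; rewrite CN negbK => /eqP-> /NE[k ->].
by rewrite CN (inj_eq Ni) eq_sym.
Qed.

(** Since [u] lies between [c] and [w] in the order, [c] is incident with [w]; this is one step of a
    walk around [c]. *)
Lemma opposite_arc c (x y u w : V) : opposite c x y -> e y u -> u != x -> e u w ->
  corner c w.
Proof.
move=> o yu ux uw; have cu := opposite_other o yu ux.
case/and3P: o => _ /andP[_ cr] _; rewrite /corner.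
case: (medial_adjP yu) cr => [[-> ru yu']|[-> ru yu']] /=; rewrite ?andbF ?andbT ?orbF.
  case: (medial_adjP uw) => [[r1 r2 uw']|[r1 r2 uw']]; first by rewrite ru in r1.
  move=> /= /eqP rc; rewrite rc r2 /= andbT.
  have : val u < c by apply: comparable_rank_lt; rewrite 1?comparable_sym ?rc ?ru.
  by move/(lt_trans uw')/gt_comparable.
case: (medial_adjP uw) => [[r1 r2 uw']|[r1 r2 uw']]; last by rewrite ru in r1.
move=> /eqP rc; rewrite rc r2 /= andbT.
have : c < val u by apply: comparable_rank_lt; rewrite ?rc ?ru.
by move/lt_trans => /(_ _ uw')/lt_comparable.
Qed.

(** * Action of polytope automorphisms on the medial layer graph *)

Lemma induced_perm (s : {perm P}) : poset_automorphism s ->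
  exists2 t : {perm V}, graph_automorphism e t & forall u, val (t u) = s (val u).
Proof.
move=> sA; pose f (u : V) : V := insubd u (s (val u)).
have fE u : val (f u) = s (val u).
  by apply: insubdK; rewrite unfold_in automorphism_rank // (valP u).
have fi : injective f.
  by move=> u v E; apply/val_inj/(@perm_inj _ s); rewrite -!fE E.
exists (perm fi) => [u v|u]; last by rewrite permE fE.
by rewrite /medial_adj (inj_eq perm_inj) !permE !fE /Order.comparable !sA.
Qed.

Lemma induced_corner (s : {perm P}) (t : {perm V}) : poset_automorphism s ->
  (forall u, val (t u) = s (val u)) -> forall c y, corner (s c) (t y) = corner c y.
Proof.
move=> sA tE c y.
by rewrite /corner tE !automorphism_rank // /Order.comparable !sA.
Qed.

Lemma induced_opposite (s : {perm P}) (t : {perm V}) : poset_automorphism s ->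
  graph_automorphism e t -> (forall u, val (t u) = s (val u)) ->
  forall c x y, opposite (s c) (t x) (t y) = opposite c x y.
Proof.
move=> sA tA tE c x y.
by rewrite /opposite tA (induced_corner sA tE) tE /Order.comparable !sA.
Qed.

(** * Connectedness *)

(** [C :\: D] is a singleton, so [C] and [D] cannot differ at two ranks. *)
Lemma adjacent_flags_share (S C D : {set P}) (x x' y y' : P) : flag_adj S C D ->
  x \in C -> x' \in D -> y \in C -> y' \in D -> rk x = rk x' -> rk y = rk y' ->
  rk x <> rk y -> x = x' \/ y = y'.
Proof.
case/and4P=> _ /flagP[_ /chainP Dc _] /cards1P[z zE] _ xC xD yC yD rx ry rxy.
have [xD'|xD'] := boolP (x \in D).
  by left; apply: comparable_rank_eq => //; apply: Dc.
have [yD'|yD'] := boolP (y \in D).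
  by right; apply: comparable_rank_eq => //; apply: Dc.
have : x \in C :\: D by rewrite inE xD'.
have : y \in C :\: D by rewrite inE yD'.
by rewrite zE !inE => /eqP yz /eqP xz; rewrite xz yz in rxy.
Qed.

(** Faces of rank [j] are joined by a path of flags; along it, two consecutive flags with different
    faces of rank [j] share their faces of all other ranks. *)
Lemma section_connected_ind (F G : P) j (Q : P -> Prop) : F <= G ->
  (rk F <= j <= rk G)%R ->
  (forall x x', F <= x <= G -> F <= x' <= G -> rk x = j -> rk x' = j -> x != x' ->
    (forall i, (rk F <= i <= rk G)%R -> i <> j ->
      exists y, [/\ F <= y <= G, rk y = i, y >=< x & y >=< x']) -> Q x -> Q x') ->
  forall x x', F <= x <= G -> F <= x' <= G -> rk x = j -> rk x' = j -> Q x -> Q x'.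
Proof.
move=> FG jj step x x' /andP[Fx xG] /andP[Fx' xG'] rx rx' Qx.
have [C Cf xC] := section_flag_through Fx xG.
have [D Df xD] := section_flag_through Fx' xG'.
have /connectP[p pP DE] := strongly_flag_connected hP FG Cf Df.
elim: p C x {Fx xG} rx Qx Cf xC pP DE => [|E p IH] C x rx Qx Cf xC /=.
  move=> _ DC; have [_ /chainP Cc _] := flagP Cf; subst D.
  by rewrite -(comparable_rank_eq (Cc _ _ xC xD)) ?rx.
case/andP=> CE pP DE; have /and4P[_ Ef _ _] := CE.
have [_ _ Er] := section_flagP FG Ef; have [_ _ Cr] := section_flagP FG Cf.
have [z zE rz] := Er j jj.
have [/subsetP CS /chainP Cc _] := flagP Cf.
have [/subsetP ES /chainP Ec _] := flagP Ef.
apply: (IH E z) => //; case: (eqVneq x z) => [<-//|xz].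
have := CS _ xC; have := ES _ zE; rewrite !inE => zS xS.
apply: (step x z) => // i ii ij.
have [y yC ry] := Cr i ii; have [y' yE ry'] := Er i ii.
exists y; have := CS _ yC; rewrite inE => ->.
have [E'|yy] := adjacent_flags_share CE xC zE yC yE (etrans rx (esym rz))
  (etrans ry (esym ry')) (fun h => ij (etrans (esym ry) (etrans (esym h) rx))).
  by rewrite E' eqxx in xz.
split=> //; first exact: Cc.
by rewrite yy; apply: Ec.
Qed.

(** The vertices with corner [c] are the faces of one rank in the section above a 0-face or below a
    facet; consecutive distinct ones share a pivot [u] and a corner [c'] of it. *)
Lemma corner_connected_ind c (Q : V -> Prop) :
  (forall (y y' u : V) c', corner c y -> corner c y' -> y != y' -> e y u -> e y' u ->
    c >=< val u -> corner c' u -> c' >=< val y -> c' >=< val y' -> Q y -> Q y') ->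
  forall y y' : V, corner c y -> corner c y' -> Q y -> Q y'.
Proof.
move=> step y0 y0' cy0 cy0' Qy0.
have [b rb lb] := least_face hP; have [t rt lt] := greatest_face hP.
have mkV x : (rk x == 1%R) || (rk x == 2%R) -> exists u : V, val u = x.
  by move=> xr; exists (Sub x xr).
have adj (u v : V) : val u >=< val v -> rk (val u) <> rk (val v) -> e u v.
  by move=> c1 N; rewrite /medial_adj c1 andbT; apply/eqP => E; rewrite E in N.
(* One argument serves both kinds of [c]: the ranks [j], [k], [l] of [y], [u], [c'] are 2, 1, 3 for
   a 0-face and 1, 2, 0 for a facet. *)
suff [F [G [j [k [l [[FG jj kk ll [jk jl]] [Hc Hv Hu]]]]]]] : exists (F G : P) (j k l : int),
    [/\ F <= G, (rk F <= j <= rk G)%R, (rk F <= k <= rk G)%R, (rk F <= l <= rk G)%R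
      & k <> j /\ l <> j] /\
    [/\ (forall y : V, corner c y <-> F <= val y <= G /\ rk (val y) = j),
     (forall x, rk x = j \/ rk x = k -> (rk x == 1%R) || (rk x == 2%R)) &
     forall (y u : V) x, corner c y -> F <= val u <= G -> rk (val u) = k -> rk x = l ->
       e y u -> F <= x <= G -> x >=< val y -> c >=< val u /\ corner x u].
  have [y0S ry0] := (Hc y0).1 cy0; have [y0S' ry0'] := (Hc y0').1 cy0'.
  have H := @section_connected_ind F G j (fun x => forall y : V, val y = x -> Q y) FG jj.
  apply: (H _ (val y0) (val y0')) => // [|y /val_inj->//].
  move=> x x' xS xS' rx rx' xx' B Qx y' y'E.
  have [|y yE] := mkV x; first by apply: Hv; left.
  have [z [zS rz zx zx']] := B k kk jk; have [c' [cS rc' cx cx']] := B l ll jl.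
  have [|u uE] := mkV z; first by apply: Hv; right.
  subst x x' z.
  have cy : corner c y by apply/Hc.
  have cy' : corner c y' by apply/Hc.
  have yu : e y u by apply: adj; rewrite 1?comparable_sym // rx rz => /esym.
  have yu' : e y' u by apply: adj; rewrite 1?comparable_sym // rx' rz => /esym.
  have [cu cu'] := Hu y u c' cy zS rz rc' yu cS cx.
  by apply: (step y y' u c') => //; apply: Qx.
case/andP: cy0 => _ /orP[|] /andP[/eqP rc _].
- exists c, t, 2%R, 1%R, 3%R; split; first by rewrite lt rc rt.
  split.
  + move=> y; rewrite /corner rc lt /= andbT orbF; split=> [/andP[cy /eqP ry]|[cy ->]].
      by split=> //; apply/ltW/comparable_rank_lt; rewrite // rc ry.
    by rewrite le_comparable.
  + by move=> x [->|->].
  + move=> y u x cy /andP[cu _] ru rx yu _ xy; split; first exact: le_comparable.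
    rewrite /corner rx ru /= andbT.
    case: (medial_adjP yu) => [[_]|[ry _ uy]]; first by rewrite ru.
    have : val y < x by apply: comparable_rank_lt; rewrite 1?comparable_sym ?ry ?rx.
    by move/(lt_trans uy)/gt_comparable.
- exists b, c, 1%R, 2%R, 0%R; split; first by rewrite lb rc rb.
  split.
  + move=> y; rewrite /corner rc lb /= ; split=> [/andP[cy /eqP ry]|[cy ->]].
      split=> //; apply/ltW/comparable_rank_lt; rewrite ?rc ?ry //.
      by rewrite comparable_sym.
    by rewrite ge_comparable.
  + by move=> x [->|->].
  + move=> y u x cy /andP[_ cu] ru rx yu _ xy; split; first exact: ge_comparable.
    rewrite /corner rx ru /= andbT.
    case: (medial_adjP yu) => [[ry _ uy]|[_]]; last by rewrite ru.
    have : x < val y by apply: comparable_rank_lt; rewrite ?ry ?rx.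
    by move/lt_trans => /(_ _ uy)/lt_comparable.
Qed.

(** It suffices to join 1-faces: consecutive ones along a path of flags share a 2-face. *)
Lemma medial_connected (u v : V) : connect e u v.
Proof.
have esym : symmetric e := @medial_adj_sym _ _ rk.
have csym := sym_connect_sym esym.
suff key (x y : V) : rk (val x) = 1%R -> rk (val y) = 1%R -> connect e x y.
  have edge (x : V) : exists2 y : V, rk (val y) = 1%R & connect e x y.
    case: (medial_rank x) => rx; first by exists x.
    have [y xy _] := neighbour_neq medial_cubic x x.
    exists y; last exact: connect1.
    by case: (medial_adjP xy) => [[]|[]//]; rewrite rx.
  have [u' ru uu] := edge u; have [v' rv vv] := edge v.
  apply: connect_trans uu _; apply: connect_trans (key _ _ ru rv) _.
  by rewrite csym.
move=> rx ry; have [b rb lb] := least_face hP; have [t rt lt] := greatest_face hP.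
pose Q z := forall w : V, val w = z -> connect e x w.
suff : Q (val y) by apply.
apply: (@section_connected_ind b t 1%R Q _ _ _ (val x)) => //.
- by rewrite rb rt.
- move=> z z' _ _ rz rz' _ /(_ 2%R) B Qz w wE.
  have [||f [_ rf fz fz']] := B; rewrite ?rb ?rt //.
  have zr : (rk z == 1%R) || (rk z == 2%R) by rewrite rz.
  have fr : (rk f == 1%R) || (rk f == 2%R) by rewrite rf.
  apply: connect_trans (Qz (Sub z zr) (SubK _ _)) _.
  apply: (@connect_trans _ _ (Sub f fr)); apply: connect1.
    rewrite /medial_adj -val_eqE !SubK comparable_sym fz andbT.
    by apply/eqP => E; rewrite -E rz in rf.
  rewrite /medial_adj -val_eqE !SubK wE fz' andbT.
  by apply/eqP => E; rewrite E rz' in rf.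
- by rewrite lb lt.
- by rewrite lb lt.
- by move=> w /val_inj->; apply: connect0.
Qed.

(** * Consequences of regularity *)

Hypothesis hreg : regular_polytope P.

Lemma flag_conjugate (C D : {set P}) : flag [set: P] C -> flag [set: P] D ->
  exists2 s : {perm P}, poset_automorphism s &
    forall x y, x \in C -> y \in D -> rk x = rk y -> s x = y.
Proof.
move=> Cf Df; have [s sA sE] := hreg Cf Df; exists s => // x y xC yD r.
have [_ /chainP Dc _] := flagP Df; apply: comparable_rank_eq.
  by apply: Dc => //; rewrite -sE imset_f.
by rewrite automorphism_rank.
Qed.

Lemma flag_through4 (v x y f : P) : v < x -> x < y -> y < f ->
  exists2 C, flag [set: P] C & [/\ v \in C, x \in C, y \in C & f \in C].
Proof.
move=> vx xy yf; have [||C Cf] := @flag_extension [set: P] [set v; x; y; f].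
- exact: subsetT.
- have vy := lt_trans vx xy; have vf := lt_trans vy yf; have xf := lt_trans xy yf.
  have L (a b : P) : a < b -> a >=< b /\ b >=< a.
    by move=> ab; rewrite lt_comparable // gt_comparable.
  apply/chainP => a b; rewrite !inE.
  by move=> /orP[/orP[/orP[]|]|] /eqP-> /orP[/orP[/orP[]|]|] /eqP->;
    rewrite ?comparablexx //; first [by apply: (L _ _ _).1 | by apply: (L _ _ _).2].
rewrite !subUset !sub1set -!andbA => /and4P[? ? ? ?].
by exists C.
Qed.

(** The corners opposite to the ends of an arc [w], together with its two inner vertices, form a
    chain [c < w 2 < w 1 < c'], which extends to a flag. Conversely, the ends are recovered as the
    neighbours opposite to [c] and [c']. *)
Lemma arc_conjugate (a b : nat -> V) : arc_seq e 3 a -> arc_seq e 3 b ->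
  rk (val (a 0%N)) = 1%R -> rk (val (b 0%N)) = 1%R ->
  exists s : {perm P}, exists t : {perm V}, [/\ poset_automorphism s,
    graph_automorphism e t, forall u, val (t u) = s (val u) &
    forall i, (i <= 3)%N -> t (a i) = b i].
Proof.
have esym : symmetric e := @medial_adj_sym _ _ rk.
have key (w : nat -> V) : arc_seq e 3 w -> rk (val (w 0%N)) = 1%R ->
    exists C c c', [/\ flag [set: P] C, opposite c (w 0%N) (w 1%N),
      opposite c' (w 3%N) (w 2%N), [/\ c \in C, val (w 2%N) \in C, val (w 1%N) \in C & c' \in C]
      & [/\ rk c = 0%R, rk (val (w 2%N)) = 1%R, rk (val (w 1%N)) = 2%R & rk c' = 3%R]].
  move=> [w1 w2] r0.
  have e01 : e (w 0%N) (w 1%N) by apply: w1.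
  have e12 : e (w 1%N) (w 2%N) by apply: w1.
  have e23 : e (w 2%N) (w 3%N) by apply: w1.
  have n02 : w 2%N != w 0%N by rewrite eq_sym; apply: w2.
  have n13 : w 1%N != w 3%N by apply: w2.
  have r1 : rk (val (w 1%N)) = 2%R by case: (medial_adjP e01) => [[]//|[]]; rewrite r0.
  have [r2 l21] : rk (val (w 2%N)) = 1%R /\ val (w 2%N) < val (w 1%N).
    by case: (medial_adjP e12) => [[]|[]//]; rewrite r1.
  have [c o] : exists c, opposite c (w 0%N) (w 1%N) by apply: opposite_corner; rewrite esym.
  have [c' o'] := opposite_corner e23.
  have rc : rk c = 0%R.
    by case/and3P: o => _ /andP[_]; rewrite r1 andbF orbF andbT => /eqP.
  have rc' : rk c' = 3%R.
    by case/and3P: o' => _ /andP[_]; rewrite r2 andbF andbT => /eqP.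
  have c2 : c < val (w 2%N).
    by apply: comparable_rank_lt; rewrite ?rc ?r2 //; apply: opposite_other o e12 n02.
  have c1 : val (w 1%N) < c'.
    apply: comparable_rank_lt; rewrite ?rc' ?r1 // comparable_sym.
    by apply: opposite_other o' _ n13; rewrite esym.
  have [C Cf inC] := flag_through4 c2 l21 c1.
  by exists C, c, c'.
move=> aA bA ra rb.
have [C [c [c' [Cf o o' [cC a2C a1C c'C] [rc ra2 ra1 rc']]]]] := key a aA ra.
have [D [f [f' [Df p p' [fD b2D b1D f'D] [rf rb2 rb1 rf']]]]] := key b bA rb.
have [s sA sE] := flag_conjugate Cf Df.
have [t tA tE] := induced_perm sA.
have t1 : t (a 1%N) = b 1%N by apply: val_inj; rewrite tE; apply: sE; rewrite ?ra1 ?rb1.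
have t2 : t (a 2%N) = b 2%N by apply: val_inj; rewrite tE; apply: sE; rewrite ?ra2 ?rb2.
have sc : s c = f by apply: sE; rewrite ?rc ?rf.
have sc' : s c' = f' by apply: sE; rewrite ?rc' ?rf'.
exists s, t; split=> // -[|[|[|[|i]]]] // _.
  by apply: opposite_inj_neighbour p; rewrite -sc -t1 induced_opposite.
by apply: opposite_inj_neighbour p'; rewrite -sc' -t2 induced_opposite.
Qed.

(** Regularity gives [s] taking [v0], one end of the 1-face [y], to the other end [v1], while fixing
    [y], a 2-face and a facet around it. *)
Lemma exists_star_flip (y : V) : rk (val y) = 1%R -> exists r, star_flip e r y.
Proof.
move=> ry; have [b rb lb] := least_face hP.
have by' : b < val y.
  by rewrite lt_neqAle lb andbT; apply/eqP => E; rewrite -E rb in ry.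
have /eqP/cards2P[v0 [v1 [v01 vE]]] := diamond hP (j := 0%R) by' rb ry.
have vP x : (x \in [set v0; v1]) = [&& rk x == 0%R, b < x & x < val y] by rewrite -vE inE.
have /and3P[/eqP r0 _ l0] : [&& rk v0 == 0%R, b < v0 & v0 < val y].
  by rewrite -vP !inE eqxx.
have /and3P[/eqP r1 _ l1] : [&& rk v1 == 0%R, b < v1 & v1 < val y].
  by rewrite -vP !inE eqxx orbT.
have [N [C [Ni Ci NE CE CN]]] := medial_star y.
have yN i : e y (N i) by apply/NE; exists i.
have Nr i : rk (val (N i)) = 2%R /\ val y < val (N i).
  by case: (medial_adjP (yN i)) => [[]//|[]]; rewrite ry.
have Cr i : rk (C i) = 3%R.
  have /CE/andP[_] : exists k, C i = C k by exists i.
  by rewrite ry andbF andbT => /eqP.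
pose i0 : 'I_3 := inord 0; pose i1 : 'I_3 := inord 1.
have i01 : i1 != i0 by rewrite -val_eqE /= !inordK.
have NC : val (N i0) < C i1.
  by apply: comparable_rank_lt; rewrite ?(Nr _).1 ?Cr // comparable_sym CN.
have [D0 D0f [v0D yD ND CD]] := flag_through4 l0 (Nr i0).2 NC.
have [D1 D1f [v1D yD' ND' CD']] := flag_through4 l1 (Nr i0).2 NC.
have [s sA sE] := flag_conjugate D0f D1f.
have [t tA tE] := induced_perm sA.
have ty : t y = y by apply: val_inj; rewrite tE; apply: sE.
have tN0 : t (N i0) = N i0 by apply: val_inj; rewrite tE; apply: sE.
have sC : s (C i1) = C i1 by apply: sE.
have sv : s v0 = v1 by apply: sE => //; rewrite r0 r1.
have oC : opposite (C i1) (N i1) y.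
  rewrite /opposite yN CN eqxx andbT; apply/CE; by exists i1.
(* The fixed facet [C i1] determines the neighbour opposite to it, which is a second fixed
   neighbour. *)
have tN1 : t (N i1) = N i1.
  by apply: opposite_inj_neighbour (oC); rewrite -{1}sC -{1}ty induced_opposite.
have fixN := fix_neighbours medial_cubic tA ty (yN i0) (yN i1).
have fN u : e y u -> t u = u.
  by apply: fixN => //; rewrite (inj_eq Ni) eq_sym.
(* If [w] were fixed, so would be the vertex of [u] opposite to [w]. That vertex lies on [y], so it
   is [v0] or [v1], and [s] moves both. *)
exists t; split=> // u w yu uw wy; apply/eqP => tw.
have [c o] := opposite_corner uw.
have sc : s c = c.
  by apply: opposite_inj_corner (o); rewrite -{1}tw -{1}(fN u yu) induced_opposite.
have cy : c >=< val y.
  by apply: opposite_other (o) _ _; rewrite 1?medial_adj_sym // eq_sym.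
have ru : rk (val u) = 2%R by case: (medial_adjP yu) => [[]//|[]]; rewrite ry.
have rc : rk c = 0%R.
  by case/and3P: o => _ /andP[_]; rewrite ru andbF orbF andbT => /eqP.
have lc : c < val y by apply: comparable_rank_lt; rewrite // rc ry.
have bc : b < c by rewrite lt_neqAle lb andbT; apply/eqP => E; rewrite -E rb in rc.
have : c \in [set v0; v1] by rewrite vP rc bc lc.
rewrite !inE => /orP[] /eqP E; move: sc; rewrite E ?sv => E'.
  by rewrite E' eqxx in v01.
by have := perm_inj (etrans sv (esym E')) => E''; rewrite E'' eqxx in v01.
Qed.

(** * Consequences of vertex transitivity *)

Hypothesis vtrans : vertex_transitive e.

Lemma medial_adj_rank (u v : V) : e u v -> (rk (val u) + rk (val v))%R = 3%R.
Proof. by move=> /medial_adjP[[-> -> _]|[-> -> _]]. Qed.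

(** The ranks at the ends of an edge add up to 3, so preservation of rank spreads along paths. *)
Lemma same_rank_all (t : {perm V}) (u v : V) : graph_automorphism e t ->
  rk (val (t u)) = rk (val u) -> rk (val (t v)) = rk (val v).
Proof.
move=> tA tu; have /connectP[p pP ->] := medial_connected u v.
elim: p u tu pP => [//|w p IH] u tu /= /andP[uw pP]; apply: IH pP.
have := medial_adj_rank uw; have : e (t u) (t w) by rewrite tA.
by move/medial_adj_rank; ilia.
Qed.

Definition swapping (t : {perm V}) :=
  graph_automorphism e t /\ forall u, rk (val (t u)) = (3 - rk (val u))%R.

(** Vertex transitivity moves some 1-face to a 2-face; by [same_rank_all] such an automorphism
    preserves the rank of no vertex. *)
Lemma exists_swapping : exists t, swapping t.
Proof.
have [x rx] := rank_onto hP (j := 1%R) isT; have [y ry] := rank_onto hP (j := 2%R) isT.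
have xr : (rk x == 1%R) || (rk x == 2%R) by rewrite rx.
have yr : (rk y == 1%R) || (rk y == 2%R) by rewrite ry.
have [t tA tx] := vtrans (Sub x xr) (Sub y yr); exists t; split=> // u.
have N : rk (val (t u)) <> rk (val u).
  by move/(same_rank_all (Sub x xr) tA); rewrite tx !SubK rx ry.
by case: (medial_rank (t u)) N => ->; case: (medial_rank u) => ->.
Qed.

Lemma swappingV t : swapping t -> swapping t^-1%g.
Proof.
move=> [tA tr]; split=> [|u]; first exact: autV.
by have := tr (t^-1%g u); rewrite permKV; ilia.
Qed.

Lemma arc_seq_image m a (t : {perm V}) : graph_automorphism e t ->
  arc_seq e m a -> arc_seq e m (fun i => t (a i)).
Proof.
move=> tA [a1 a2]; split=> i im; first by rewrite tA a1.
by rewrite (inj_eq perm_inj) a2.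
Qed.

(** Two arcs starting at 1-faces are handled by [arc_conjugate]; two starting at 2-faces end at
    1-faces and are reversed first; in the mixed case a rank-reversing automorphism is applied
    beforehand. *)
Lemma medial_arc_trans3 : arc_trans e 3.
Proof.
have esym : symmetric e := @medial_adj_sym _ _ rk.
have same a b : arc_seq e 3 a -> arc_seq e 3 b ->
    rk (val (a 0%N)) = rk (val (b 0%N)) ->
    exists2 s : {perm V}, graph_automorphism e s & forall i, (i <= 3)%N -> s (a i) = b i.
  move=> aA bA; case: (medial_rank (a 0%N)) => r0 rab.
    by have [|s [t [_ tA _ tE]]] := arc_conjugate aA bA r0; [rewrite -rab|exists t].
  have last (c : nat -> V) : arc_seq e 3 c -> rk (val (c 0%N)) = 2%R -> rk (val (c 3%N)) = 1%R.
    move=> [c1 _] rc; have := medial_adj_rank (c1 0%N isT).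
    have := medial_adj_rank (c1 1%N isT); have := medial_adj_rank (c1 2%N isT).
    by ilia.
  have [||s [t [_ tA _ tE]]] := arc_conjugate (arc_rev esym aA) (arc_rev esym bA).
  - exact: last.
  - by apply: last => //; rewrite -rab.
  exists t => // i i3; have := tE (3 - i)%N (leq_subr _ _).
  by rewrite subKn.
move=> a b aA bA; have [t [tA tr]] := exists_swapping.
have [r|r] : rk (val (a 0%N)) = rk (val (b 0%N)) \/ rk (val (t (a 0%N))) = rk (val (b 0%N)).
- rewrite tr; case: (medial_rank (a 0%N)) => ->; case: (medial_rank (b 0%N)) => ->;
  by [left|right].
- exact: same.
have [s sA sE] := same _ _ (arc_seq_image tA aA) bA r.
by exists (t * s)%g => [|i i3]; [apply: autM|rewrite permM sE].
Qed.

Lemma medial_star_flip (y : V) : exists r, star_flip e r y.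
Proof.
case: (medial_rank y) => ry; first exact: exists_star_flip.
have [t tS] := exists_swapping; have [_ tr] := swappingV tS.
have [|r rF] := @exists_star_flip (t^-1%g y); first by rewrite tr ry.
by exists (t^-1 * r * t)%g; rewrite -[y](permKV t); apply: star_flip_conj rF; case: tS.
Qed.

Lemma exists_edge : exists x : V, rk (val x) = 1%R.
Proof.
have [x rx] := rank_onto hP (j := 1%R) isT.
have xr : (rk x == 1%R) || (rk x == 2%R) by rewrite rx.
by exists (Sub x xr); rewrite SubK.
Qed.

Lemma medial_not_arc_trans4 : ~ arc_trans e 4.
Proof.
have [x _] := exists_edge; have [r rF] := medial_star_flip x.
apply: (not_arc_trans4 (@medial_adj_sym _ _ rk) medial_cubic medial_connected rF).
Qed.

(** [t] agrees on some 3-arc with an automorphism [t'] induced by the polytope, and [trans_rigid]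
    for 3-arcs gives [t' = t]. *)
Lemma automorphism_induced (t : {perm V}) (u : V) : graph_automorphism e t ->
  rk (val (t u)) = rk (val u) ->
  exists2 s : {perm P}, poset_automorphism s & forall u, val (t u) = s (val u).
Proof.
move=> tA tu; have [x rx] := exists_edge.
have [y xy _] := neighbour_neq medial_cubic x x.
have [a aA [a0 _]] := exists_arc medial_cubic xy.
have [||s [t' [sA tA' tE' tE]]] := arc_conjugate (aA 3) (arc_seq_image tA (aA 3)).
- by rewrite a0.
- by rewrite a0 (same_rank_all x tA tu).
suff E : t' = t by exists s => // v; rewrite -E.
apply/eqP; rewrite eq_mulgV1; apply/eqP.
have kA : graph_automorphism e (t' * t^-1)%g := autM tA' (autV tA).
apply: (trans_rigid (@medial_adj_sym _ _ rk) medial_cubic medial_connected _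
  medial_arc_trans3 medial_not_arc_trans4 (aA 3) kA) => // i i3.
by rewrite permM tE // permK.
Qed.

(** * Action of a rank-reversing automorphism on 0-faces and facets *)

Lemma fixes_corner (s : {perm P}) (t : {perm V}) c (w : V) : poset_automorphism s ->
  graph_automorphism e t -> (forall u, val (t u) = s (val u)) ->
  t w = w -> (forall u, e w u -> t u = u) -> corner c w -> s c = c.
Proof.
move=> sA tA tE tw tN cw; have [x o] := opposite_neighbour cw.
have wx : e w x by case/and3P: o.
by apply: opposite_inj_corner (o); rewrite -{1}(tN x wx) -{1}tw induced_opposite.
Qed.

Lemma exists_corner c : rk c = 0%R \/ rk c = 3%R -> exists y : V, corner c y.
Proof.
have [b rb lb] := least_face hP; have [t rt lt] := greatest_face hP.
case=> rc.
  have [|z [cz _ rz]] := face_between (lt c) (j := 2%R); first by rewrite rc rt.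
  have zr : (rk z == 1%R) || (rk z == 2%R) by rewrite rz.
  by exists (Sub z zr); rewrite /corner SubK rc rz le_comparable.
have [|z [_ cz rz]] := face_between (lb c) (j := 1%R); first by rewrite rc rb.
have zr : (rk z == 1%R) || (rk z == 2%R) by rewrite rz.
by exists (Sub z zr); rewrite /corner SubK rc rz ge_comparable.
Qed.

Lemma corner_rank c (y : V) : corner c y ->
  (rk c = 0%R /\ rk (val y) = 2%R) \/ (rk c = 3%R /\ rk (val y) = 1%R).
Proof. by case/andP=> _ /orP[] /andP[/eqP-> /eqP->]; [left|right]. Qed.

(* Walking around the corner [c], each step is realised by a star flip [r] at the
   third neighbour [w] of the pivot [u]; its conjugate by [t] is again a star
   flip, so it comes from a polytope automorphism and fixes the image corner. *)
Lemma dual_corner t c : swapping t -> rk c = 0%R \/ rk c = 3%R ->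
  exists2 c', rk c' = (3 - rk c)%R &
    forall x y : V, opposite c x y -> opposite c' (t x) (t y).
Proof.
move=> [tA tr] rc; have esym : symmetric e := @medial_adj_sym _ _ rk.
(* The image of [c] is read off at one vertex [y0]; the walk around [c] then shows that it is the
   same at all others. *)
have [y0 cy0] := exists_corner rc; have [x0 o0] := opposite_neighbour cy0.
have [c' o0'] : exists c', opposite c' (t x0) (t y0).
  by apply: opposite_corner; rewrite tA; case/and3P: o0.
exists c'.
  have /corner_rank := cy0.
  have /corner_rank : corner c' (t y0) by case/and3P: o0'.
  by rewrite tr => -[[-> E]|[-> E]] [[-> E']|[-> E']] //; rewrite E' in E.
pose Q (y : V) := forall x, opposite c x y -> opposite c' (t x) (t y).
suff all y : corner c y -> Q y by move=> x y o; apply: all => //; case/and3P: o.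
move=> cy; apply: (@corner_connected_ind c Q _ y0 y) => //; last first.
  by move=> x /(opposite_inj_neighbour o0) <-.
move=> {y cy} y y' u d' cy cy' yy' yu yu' cu d'u d'y d'y' Qy x' o'.
(* [d'] is incident with [y] and [y'] but not with [w], so [w] is the third neighbour of [u]. *)
have [w ow] := opposite_neighbour d'u.
have /and3P[uw _ nw] := ow.
have wy : w != y by apply: contraNneq nw => ->.
have wy' : w != y' by apply: contraNneq nw => ->.
have [r [rA rw rN rF]] := medial_star_flip w.
have wu : e w u by rewrite esym.
have uy : e u y by rewrite esym.
have uy' : e u y' by rewrite esym.
have ru : r u = u by apply: rN.
have yw : y != w by rewrite eq_sym.
(* [r] fixes [u] and [w] and moves [y], so it exchanges [y] and [y']. *)
have ry : r y = y'.
  apply: (@last_neighbour _ e medial_cubic u w y) => //.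
  - by rewrite -{1}ru rA.
  - by rewrite -{1}rw (inj_eq perm_inj).
  - exact: (rF u).
  - by rewrite eq_sym.
  - by rewrite eq_sym.
have [|s sA sE] := @automorphism_induced r w rA; first by rewrite rw.
have [x o] := opposite_neighbour cy.
have ux : u != x by apply: contraTneq cu => ->; case/and3P: o.
have cw : corner c w by apply: opposite_arc o yu ux uw.
have sc : s c = c by apply: (fixes_corner sA rA sE rw rN cw).
have x'E : r x = x'.
  by apply: opposite_inj_neighbour o'; rewrite -sc -ry induced_opposite.
pose k := (t^-1 * r * t)%g.
have kE z : k (t z) = t (r z) by rewrite !permM permK.
have kA : graph_automorphism e k := autM (autM (autV tA) rA) tA.
have kw : k (t w) = t w by rewrite kE rw.
have [|s' sA' sE'] := @automorphism_induced k (t w) kA; first by rewrite kw.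
have oQ := Qy x o.
have cw' : corner c' (t w).
  by apply: (@opposite_arc c' (t x) (t y) (t u)); rewrite ?tA ?(inj_eq perm_inj).
have kN z : e (t w) z -> k z = z.
  by rewrite -[z](permKV t) tA kE => /rN->.
have sc' := fixes_corner sA' kA sE' kw kN cw'.
by rewrite -x'E -ry -!kE -sc' induced_opposite.
Qed.

(** * Construction of the duality *)

(** [y] is the image of [x] under the duality built from [t]: the rank settles the least and
    greatest faces, the second clause the 1-faces and 2-faces, the third the 0-faces and facets. *)
Definition dual_image (t : {perm V}) x y := [/\ rk y = (3 - rk x)%R,
  forall u : V, val u = x -> y = val (t u) &
  forall u w : V, opposite x u w -> opposite y (t u) (t w)].

Lemma rank_cases x :
  [\/ rk x = (-1)%R \/ rk x = 4%R, rk x = 0%R \/ rk x = 3%R | exists u : V, val u = x].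
Proof.
have [r1 r2] := rank_bounds x.
have [h|[h|h]] : (rk x = (-1) \/ rk x = 4)%R \/ (rk x = 0 \/ rk x = 3)%R \/
   (rk x = 1 \/ rk x = 2)%R by ilia.
- by constructor 1.
- by constructor 2.
constructor 3.
have xr : (rk x == 1%R) || (rk x == 2%R) by case: h => ->.
by exists (Sub x xr); rewrite SubK.
Qed.

Lemma dual_image_exists t x : swapping t -> exists y, dual_image t x y.
Proof.
move=> tS; have [b rb lb] := least_face hP; have [tp rt lt] := greatest_face hP.
case: (rank_cases x) => [h|h|[u <-]].
- have [y ry] : exists y, rk y = (3 - rk x)%R.
    by case: h => ->; [exists tp; rewrite rt|exists b; rewrite rb].
  exists y; split=> //.
  + by move=> u ux; case: (medial_rank u); rewrite ux; case: h => ->.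
  + by move=> u w /and3P[_ /corner_rank[[r _]|[r _]] _]; move: h; rewrite r => -[].
- have [c rc o] := dual_corner tS h.
  exists c; split=> // u ux.
  by case: (medial_rank u); rewrite ux; case: h => ->.
- exists (val (t u)); split; first exact: tS.2.
  + by move=> v /val_inj->.
  + by move=> v w /and3P[_ /corner_rank[[r _]|[r _]] _]; case: (medial_rank u); rewrite r.
Qed.

Lemma dual_imageK t x y z : dual_image t x y -> dual_image t^-1%g y z -> z = x.
Proof.
move=> [ry yV yo] [rz zV zo].
have rzx : rk z = rk x by rewrite rz ry; ilia.
have [b rb lb] := least_face hP; have [tp rt lt] := greatest_face hP.
case: (rank_cases x) => [h|h|[u ux]].
- have uniq' w w' : rk w = rk w' -> rk w = (-1)%R \/ rk w = 4%R -> w = w'.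
    move=> E [r|r].
      have eb v : rk v = (-1)%R -> v = b.
        by move=> rv; apply: comparable_rank_eq; [exact: ge_comparable|rewrite rb].
      by rewrite (eb w) // (eb w') // -E.
    have et v : rk v = 4%R -> v = tp.
      by move=> rv; apply: comparable_rank_eq; [exact: le_comparable|rewrite rt].
    by rewrite (et w) // (et w') // -E.
  by apply: uniq' => //; rewrite rzx.
- have [w cw] := exists_corner h; have [u o] := opposite_neighbour cw.
  apply: opposite_inj_corner (o).
  by have := zo _ _ (yo _ _ o); rewrite !permK.
- by rewrite (zV _ (esym (yV u ux))) permK.
Qed.

(** If [c] is no corner of [u], it is one of a neighbour [y] of [u], and [u] is not opposite to it
    there; the third clause of [dual_image] transports this. *)
Lemma dual_image_comparable t c c' (u : V) : swapping t -> dual_image t c c' ->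
  rk c = 0%R \/ rk c = 3%R -> c >=< val u -> c' >=< val (t u).
Proof.
move=> [tA tr] [_ _ o'] rc cu.
case: (boolP (corner c u)) => [cu'|ncu].
  have [x o] := opposite_neighbour cu'.
  by case/and3P: (o' _ _ o) => _ /andP[].
have [y uy _] := neighbour_neq medial_cubic u u.
have yu : e y u by rewrite medial_adj_sym.
have cy : corner c y.
  move: ncu; rewrite /corner cu /=.
  case: (medial_adjP uy) rc => [[ru ry l]|[ru ry l]] [rc|rc]; rewrite rc ru ry //= => _.
    have : c < val u by apply: comparable_rank_lt; rewrite // rc ru.
    by rewrite andbT => /lt_trans/(_ l)/lt_comparable.
  have : val u < c by apply: comparable_rank_lt; rewrite 1?comparable_sym // rc ru.
  by rewrite andbT => /(lt_trans l)/gt_comparable.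
have [x o] := opposite_neighbour cy.
apply: opposite_other (o' _ _ o) _ _; first by rewrite tA.
by rewrite (inj_eq perm_inj); apply: contraTneq cu => ->; case/and3P: o.
Qed.

Lemma dual_image_anti t x y x' y' : swapping t -> dual_image t x x' ->
  dual_image t y y' -> x < y -> y' <= x'.
Proof.
move=> tS; have [tA tr] := tS.
have [b rb lb] := least_face hP; have [tp rt lt] := greatest_face hP.
have lt_dual (w w' z z' : P) : rk z = (3 - rk w)%R -> rk z' = (3 - rk w')%R -> w < w' ->
    z >=< z' -> z' <= z.
  move=> rz rz' /(rank_mono hP) ww' zz'; apply/ltW/comparable_rank_lt.
    by rewrite comparable_sym.
  by ilia.
have half (c c' : P) (u : V) : dual_image t c c' -> rk c = 0%R \/ rk c = 3%R ->
    (c < val u -> val (t u) <= c') /\ (val u < c -> c' <= val (t u)).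
  move=> D rc; have [rc' _ _] := D; split=> l.
    apply: (lt_dual _ _ _ _ rc' (tr u) l).
    by apply: dual_image_comparable D rc _ => //; apply: lt_comparable.
  apply: (lt_dual _ _ _ _ (tr u) rc' l); rewrite comparable_sym.
  by apply: dual_image_comparable D rc _ => //; apply: gt_comparable.
move=> Dx Dy xy; have [rx xV xo] := Dx; have [ry yV yo] := Dy.
have rxy := rank_mono hP xy.
have top w : rk w = 4%R -> w = tp.
  by move=> rw; apply: comparable_rank_eq; [exact: le_comparable|rewrite rt].
have bot w : rk w = (-1)%R -> w = b.
  by move=> rw; apply: comparable_rank_eq; [exact: ge_comparable|rewrite rb].
have [bx tx] := rank_bounds x; have [bY ty] := rank_bounds y.
case: (rank_cases x) => [[h|h]|hx|[u ux]].
- by rewrite (top x') ?lt // rx h.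
- by ilia.
- case: (rank_cases y) => [[h|h]|hy|[v vy]].
  + by ilia.
  + by rewrite (bot y') ?lb // ry h.
  + have [r0 r3] : rk x = 0%R /\ rk y = 3%R by move: hx hy; ilia.
    (* For a 0-face below a facet, a 1-face between them reduces the claim to two uses of [half]. *)
    have [|z [xz zy rz]] := face_between (ltW xy) (j := 1%R); first by rewrite r0 r3.
    have zr : (rk z == 1%R) || (rk z == 2%R) by rewrite rz.
    pose w : V := Sub z zr; have wz : val w = z by rewrite SubK.
    apply: (@le_trans _ _ (val (t w))).
      apply: (half _ _ w Dy hy).2; rewrite wz lt_neqAle zy andbT.
      by apply/eqP => E; rewrite E r3 in rz.
    apply: (half _ _ w Dx hx).1; rewrite wz lt_neqAle xz andbT.
    by apply/eqP => E; rewrite -E r0 in rz.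
  + by rewrite (yV v vy); apply: (half _ _ v Dx hx).1; rewrite vy.
- case: (rank_cases y) => [[h|h]|hy|[v vy]].
  + by ilia.
  + by rewrite (bot y') ?lb // ry h.
  + by rewrite (xV u ux); apply: (half _ _ u Dy hy).2; rewrite ux.
  + apply: (lt_dual _ _ _ _ rx ry xy); rewrite (xV u ux) (yV v vy).
    have : e u v by apply: lt_medial_adj; rewrite ux vy.
    by rewrite -tA => /andP[].
Qed.

(** The maps [f] and [g] built from [t] and [t^-1] both reverse the order, and [g] undoes [f];
    applying [g] gives the converse implication. *)
Lemma polytope_self_dual : self_dual P.
Proof.
have [t tS] := exists_swapping; have tS' := swappingV tS.
have [f fE] := fin_all_exists (fun x => dual_image_exists x tS).
have [g gE] := fin_all_exists (fun x => dual_image_exists x tS').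
have fK x : g (f x) = x by apply: dual_imageK (fE x) (gE _).
have fi : injective f := can_inj fK.
have anti h s (hE : forall x, dual_image s x (h x)) : swapping s ->
    forall x y, x <= y -> h y <= h x.
  move=> sS x y; rewrite le_eqVlt => /orP[/eqP->|xy]; first exact: lexx.
  exact: dual_image_anti sS (hE x) (hE y) xy.
exists (perm fi) => x y; rewrite !permE; apply/idP/idP => [|yx].
  by move/(anti _ _ gE tS'); rewrite !fK.
exact: (anti _ _ fE tS).
Qed.

Lemma medial_t_transitive3 : t_transitive e 3.
Proof.
split; first exact/arc_transitiveE/medial_arc_trans3.
by move/arc_transitiveE/medial_not_arc_trans4.
Qed.

End Polytope.

Theorem theorem2 (d : Order.disp_t) (P : finPOrderType d) (rk : P -> int)
    (q : nat) (hq : 2 <= q)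
    (hP : abstract_4polytope rk) (hreg : regular_polytope P)
    (htype : of_type rk 3 q 3) :
  vertex_transitive (medial_adj rk) ->
  t_transitive (medial_adj rk) 3 /\ self_dual P.
Proof.
case: htype => h1 _ h3 vt; split.
  exact: (medial_t_transitive3 hP h1 h3 hreg vt).
exact: (polytope_self_dual hP h1 h3 hreg vt).
Qed.
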